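(* Let $\beta=r/s$, where $r>s>0$ are integers with $\gcd(r,s)=1$. Let $F,G\in\mathbb{R}[X,Y]$ be $\beta$-quasihomogeneous polynomials of degree $d\geq1$, none of which being of the form $cX^d$, and let $f_+,f_-$ be the height functions of $F$ and $g_+,g_-$ the height functions of $G$. Suppose that $(g_+,g_-)\circ(\lambda,\phi)=(f_+,f_-)$ for some proto-transition $(\lambda,\phi)$. If any of the following conditions is satisfied, then $F$ and $G$ are $\mathcal{R}$-semialgebraically Lipschitz equivalent: (a) $r$ is even or $s$ is odd; (b) $\lambda_1=\lambda_2$; (c) none of the polynomials $F,G$ has $X$ as a factor.
   Context: A nonzero polynomial $F\in\mathbb{R}[X,Y]$ is $\beta$-quasihomogeneous of degree $d$ ($d\ge1$ an integer) if $F(tX,t^\beta Y)=t^dF(X,Y)$ for all $t>0$. Its right and left height functions are $f_+(t)=F(1,t)$ and $f_-(t)=F(-1,t)$. Two $\beta$-quasihomogeneous polynomials $F,G$ of degree $d$ are $\mathcal{R}$-semialgebraically Lipschitz equivalent if there exists a germ of semialgebraic bi-Lipschitz homeomorphism $\Phi:(\mathbb{R}^2,0)\to(\mathbb{R}^2,0)$ such that $G\circ\Phi=F$. A proto-transition is a pair $(\lambda,\phi)$ where $\lambda=(\lambda_1,\lambda_2)$ is a pair of nonzero real numbers with $\lambda_1\lambda_2>0$ and $\phi=(\phi_1,\phi_2)$ is a pair of bi-Lipschitz Nash diffeomorphisms of $\mathbb{R}$. Write $\lambda>0$ if $\lambda_1,\lambda_2>0$ and $\lambda<0$ if $\lambda_1,\lambda_2<0$.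 For real analytic functions $g_1,g_2$ on $\mathbb{R}$ (and the given $d$), $$(g_1,g_2)\circ(\lambda,\phi)=\begin{cases}(|\lambda_1|^dg_1\circ\phi_1,\ |\lambda_2|^dg_2\circ\phi_2),&\lambda>0,\\(|\lambda_1|^dg_2\circ\phi_1,\ |\lambda_2|^dg_1\circ\phi_2),&\lambda<0.\end{cases}$$ *)

(* Defs.v *)
From HB Require Import structures.
From mathcomp Require Import all_boot all_order all_algebra.
From mathcomp Require Import all_classical all_reals all_analysis.
(* Not imported: its notations clash with those of MathComp-Analysis. *)
From mathcomp Require mpoly.

Set Implicit Arguments.
Unset Strict Implicit.
Unset Printing Implicit Defensive.

Import Order.TTheory GRing.Theory Num.Theory.
Import numFieldNormedType.Exports.

Local Open Scope classical_set_scope.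
Local Open Scope ring_scope.

(* Bivariate polynomials F in R[X, Y] are elements of {poly {poly R}} with the
   conventions of polyXY: X is the outer variable 'X, Y is 'Y = 'X%:P, and
   F(x, y) is F.[x, y]. *)

(* F(t X, u Y) *)
Definition scaleXY (R : realType) (t u : R) (F : {poly {poly R}}) :
    {poly {poly R}} :=
  map_poly (comp_poly (u *: 'X)) F \Po (t%:P *: 'X).

Definition quasihomogeneous (R : realType) (beta : R) (d : nat)
    (F : {poly {poly R}}) : Prop :=
  F != 0 /\ forall t : R, 0 < t -> scaleXY t (t `^ beta) F = (t ^+ d)%:P *: F.

Definition height_right (R : realType) (F : {poly {poly R}}) : R -> R :=
  fun t => F.[1, t].

Definition height_left (R : realType) (F : {poly {poly R}}) : R -> R :=
  fun t => F.[-1, t].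

Definition has_factor_X (R : realType) (F : {poly {poly R}}) : Prop :=
  exists H : {poly {poly R}}, F = 'X * H.

(* The smallest Boolean algebra of subsets of R^n that contains all the sets
   {p = 0} and {p > 0}, p in R[X_1, ..., X_n] *)
Inductive semialgebraic (R : realType) (n : nat) : set (set 'rV[R]_n) :=
| semialgebraic_eq0 (p : mpoly.mpoly n R) :
    semialgebraic [set v | mpoly.meval (fun i => v ord0 i) p = 0]
| semialgebraic_gt0 (p : mpoly.mpoly n R) :
    semialgebraic [set v | 0 < mpoly.meval (fun i => v ord0 i) p]
| semialgebraicC (A : set 'rV[R]_n) : semialgebraic A -> semialgebraic (~` A)
| semialgebraicU (A B : set 'rV[R]_n) :
    semialgebraic A -> semialgebraic B -> semialgebraic (A `|` B)
| semialgebraicI (A B : set 'rV[R]_n) :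
    semialgebraic A -> semialgebraic B -> semialgebraic (A `&` B).

Definition semialgebraic_map (R : realType) (m n : nat) (A : set 'rV[R]_m)
    (f : 'rV[R]_m -> 'rV[R]_n) : Prop :=
  semialgebraic A /\ semialgebraic [set row_mx v (f v) | v in A].

(* On 'rV[R]_2 the norm of the library is the sup norm; being equivalent to the
   Euclidean norm, it yields the same bi-Lipschitz maps. *)
Definition bilipschitz_on (R : realType) (V W : normedModType R) (A : set V)
    (f : V -> W) : Prop :=
  exists2 K : R, 0 < K & forall x y, A x -> A y ->
    K^-1 * `|x - y| <= `|f x - f y| <= K * `|x - y|.

(* Nash function on R: semialgebraic of class C^oo (equivalently, semialgebraic
   and real analytic) *)
Definition nash (R : realType) (f : R -> R) : Prop :=
  semialgebraic_map [set: 'rV[R]_1]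
    (fun v : 'rV[R]_1 => (f (v ord0 ord0))%:M : 'rV[R]_1) /\
  forall (n : nat) (x : R), derivable (derive1n n (f : R^o -> R^o)) x 1.

Definition nash_diffeomorphism (R : realType) (f : R -> R) : Prop :=
  nash f /\ exists g : R -> R, [/\ cancel f g, cancel g f & nash g].

Definition proto_transition (R : realType) (lambda : R * R)
    (phi : (R -> R) * (R -> R)) : Prop :=
  [/\ [/\ lambda.1 != 0, lambda.2 != 0 & 0 < lambda.1 * lambda.2],
      nash_diffeomorphism phi.1 /\ bilipschitz_on [set: R^o] (phi.1 : R^o -> R^o)
    & nash_diffeomorphism phi.2 /\ bilipschitz_on [set: R^o] (phi.2 : R^o -> R^o)].

(* (g_1, g_2) o (lambda, phi), for lambda as in a proto-transition: the second
   branch is the case lambda_1, lambda_2 < 0. *)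
Definition proto_comp (R : realType) (d : nat) (g : (R -> R) * (R -> R))
    (lambda : R * R) (phi : (R -> R) * (R -> R)) : (R -> R) * (R -> R) :=
  if (0 < lambda.1) && (0 < lambda.2) then
    ((fun t => `|lambda.1| ^+ d * g.1 (phi.1 t)),
     (fun t => `|lambda.2| ^+ d * g.2 (phi.2 t)))
  else
    ((fun t => `|lambda.1| ^+ d * g.2 (phi.1 t)),
     (fun t => `|lambda.2| ^+ d * g.1 (phi.2 t))).

(* The germ Phi is given by a representative, a bijection between open
   neighbourhoods U and V of the origin; the bi-Lipschitz bounds make it a
   homeomorphism. *)
Definition semialg_lipschitz_equivalent (R : realType)
    (F G : {poly {poly R}}) : Prop :=
  exists (U V : set 'rV[R]_2) (Phi : 'rV[R]_2 -> 'rV[R]_2),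
    [/\ [/\ open U, open V, U 0 & V 0],
        set_bij U V Phi /\ Phi 0 = 0,
        semialgebraic_map U Phi,
        bilipschitz_on U Phi
      & forall v, U v ->
          G.[Phi v ord0 ord0, Phi v ord0 ord_max] = F.[v ord0 ord0, v ord0 ord_max]].

(* Main.v *)
Require Import Defs.
From HB Require Import structures.
From mathcomp Require Import all_boot all_order all_algebra.
From mathcomp Require Import all_classical all_reals all_analysis.
From mathcomp Require polyorder polyrcf.
(* Only the algebraic structures: the notations for polynomials in several
   variables clash with those of analysis. *)
From mathcomp Require Import (canonicals) mpoly.
From mathcomp Require Import ring lra.

Set Implicit Arguments.
Unset Strict Implicit.
Unset Printing Implicit Defensive.

Import Order.TTheory GRing.Theory Num.Theory.
Import numFieldNormedType.Exports.

Local Open Scope classical_set_scope.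
Local Open Scope ring_scope.

(** Put [beta = r / s].  A [beta]-quasihomogeneous [F] satisfies
    [F (x z, x^beta y) = x^d F (z, y)] for [x > 0], so [F] is determined by its
    restrictions to the lines [X = 1] and [X = -1], and a relation between the
    height functions of [F] and [G] lifts to the plane.  After rescaling, the
    proto-transition provides, for each side [b] of the vertical axis, a
    diffeomorphism [psi b] of the line with [P (psi b t) = Q t], where [P] and
    [Q] are the restrictions of [G] and [F] to vertical lines.  The wanted map
    is, with [a = |x|^beta],
      [(x, y) |-> (eps * l b * x, a * psi b (y / a))],
    extended by [(0, y) |-> (0, M * y)].  It is considered on the vertical strip
    [|x| < 1], where [x |-> |x|^beta] is Lipschitz because [beta > 1].

    Metric part.  In [y] the map is bi-Lipschitz because [psi b] is.  In [a] the
    derivative of [a * psi (y / a)] is [psi t - t * psi' t] at [t = y / a], so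
    this quantity has to be bounded ([slope_bounded]).  Differentiating
    [P (psi t) = Q t] and comparing with Euler's identity up to terms of lower
    degree gives [(psi t - t * psi' t) * P' (psi t) = O (|t|^(n - 1))], whereas
    [P' (psi t)] has exact order [|t|^(n - 1)].  The same comparison of leading
    terms shows that [psi t - M * t] is bounded for an explicit slope [M]
    ([asymptotic_slope]), which makes the extension to the axis Lipschitz.

    Matching the two sides.  Both sides must have the same slope [M].  Its
    absolute value only depends on the leading coefficients and on [l b], and it
    is the same on both sides when [l true = l false] or when [X] does not
    divide [G].  For the sign, both [psi b] must be monotone in the same
    direction.  If [s] is odd, [F] and [G] have a symmetry exchanging the
    two half-planes, so that the left map can be taken to be the conjugate of
    the right one ([equivalence_odd]); as [r] and [s] are coprime, condition (a)
    means precisely that [s] is odd.  If [s] is even, then [r] is odd, [F] is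
    even in [Y], and the left map can be precomposed with [t |-> -t]
    ([equivalence_even]).

    Semialgebraicity.  No projection is needed.  By Rolle's theorem two points
    with the same image under [P] and the same position with respect to all
    critical points of [P] are equal, hence [w = psi t] if and only if
    [P w = Q t] and, for each critical point [c] of [P], [c < w] if and only if
    [c < psi t] ([eq_of_same_branch]).  By monotonicity of [psi], after
    homogenization, the graph is described by [G (u, v) = F (x, y)] and by finitely
    many conditions of the form [c * x^beta < y], which are semialgebraic
    ([semialgebraic_lt_powR]). *)

(** * Growth of real polynomials *)

Section PolynomialGrowth.
Variable R : realFieldType.
Implicit Types (p : {poly R}) (t : R).

(** The weight [(1 + `|t|) ^+ m] rather than [`|t| ^+ m] gives a bound valid on
    the whole line, which composes well with Lipschitz maps. *)
Lemma poly_growth_ub p m : (size p <= m.+1)%N ->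
  exists2 C : R, 0 < C & forall t, `|p.[t]| <= C * (1 + `|t|) ^+ m.
Proof.
move=> szp; exists (1 + \sum_(i < size p) `|p`_i|).
  by rewrite ltr_pwDl // sumr_ge0.
move=> t; have t1 : 1 <= 1 + `|t| by rewrite lerDl.
rewrite horner_coef (le_trans (ler_norm_sum _ _ _)) //.
rewrite mulrDl mul1r mulr_suml ler_wpDl ?exprn_ge0 ?addr_ge0 //.
apply: ler_sum => i _; rewrite normrM normrX ler_wpM2l //.
apply: le_trans (_ : (1 + `|t|) ^+ i <= _).
  by rewrite lerXn2r ?nnegrE ?addr_ge0 // lerDr.
by rewrite ler_weXn2l // -ltnS (leq_trans (ltn_ord i)).
Qed.

Lemma poly_sub_lead p m : size p = m.+1 ->
  (size (p - lead_coef p *: 'X^m)%R <= m)%N.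
Proof.
move=> szp; apply/leq_sizeP => j; rewrite leq_eqVlt => /predU1P [<-|mj].
  by rewrite coefB coefZ coefXn eqxx mulr1 lead_coefE szp subrr.
rewrite coefB coefZ coefXn gtn_eqF // mulr0 subr0 nth_default //.
by rewrite szp.
Qed.

Lemma weight_le m t : 1 <= `|t| -> (1 + `|t|) ^+ m <= 2 ^+ m * `|t| ^+ m.
Proof.
move=> t1; rewrite -exprMn lerXn2r ?nnegrE ?addr_ge0 ?mulr_ge0 //.
by rewrite mulrDl mul1r lerD2r.
Qed.

(** For large [t] the leading term is at least twice the rest, which is
    [O (`|t| ^+ (m - 1))]. *)
Lemma poly_growth_lb p m : size p = m.+1 ->
  exists c T : R, [/\ 0 < c, 1 <= T &
    forall t, T <= `|t| -> c * `|t| ^+ m <= `|p.[t]|].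
Proof.
move=> szp; set a := lead_coef p.
have a0 : 0 < `|a| by rewrite normr_gt0 lead_coef_eq0 -size_poly_eq0 szp.
have [q [szq pE]] : exists q : {poly R}, (size q <= m)%N /\ p = q + a *: 'X^m.
  by exists (p - a *: 'X^m); rewrite poly_sub_lead // subrK.
case: m szq pE szp => [|m] szq pE szp.
  move: szq; rewrite leqn0 size_poly_eq0 => /eqP q0.
  exists `|a|, 1; split => // t _.
  by rewrite pE q0 add0r expr0 hornerZ hornerXn !expr0 !mulr1.
have [C C0 hC] := poly_growth_ub szq.
pose T := Num.max 1 (2 * (C * 2 ^+ m) / `|a|).
exists (`|a| / 2), T; split; [by rewrite divr_gt0| by rewrite le_max lexx |].
move=> t; rewrite ge_max => /andP [t1]; rewrite ler_pdivrMr // => tT.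
have := hC t; rewrite pE hornerD hornerZ hornerXn => hq.
have hw := weight_le m t1.
have : `|a| * `|t| ^+ m.+1 - `|q.[t]| <= `|q.[t] + a * t ^+ m.+1|.
  rewrite -normrX -normrM [q.[t] + _]addrC; exact: lerB_normD.
apply: le_trans; rewrite lerBrDr -lerBrDl.
have -> : `|a| * `|t| ^+ m.+1 - `|a| / 2 * `|t| ^+ m.+1
  = (`|t| * `|a| / 2) * `|t| ^+ m by rewrite exprS; field.
apply: (le_trans hq); apply: (le_trans (ler_wpM2l (ltW C0) hw)).
rewrite mulrA ler_wpM2r ?exprn_ge0 //; lra.
Qed.

(** A converse of [poly_growth_ub]: the degree can be read off the growth. *)
Lemma poly_growth_size p m C : 0 <= C ->
  (forall t, `|p.[t]| <= C * (1 + `|t|) ^+ m) -> (size p <= m.+1)%N.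
Proof.
move=> C0 hC; case szp : (size p) => [//|k]; rewrite ltnS leqNgt; apply/negP => mk.
have [c [T [c0 T1 hT]]] := poly_growth_lb szp.
have [q qE] : exists q, k = (m + q.+1)%N.
  by exists (k - m.+1)%N; rewrite addnS -addSn subnKC.
pose t := Num.max T (C * 2 ^+ m / c + 1).
have t1 : 1 <= t by rewrite le_max T1.
have t0 : 0 < t by apply: lt_le_trans t1.
have nt : `|t| = t by rewrite gtr0_norm.
have /hT : T <= `|t| by rewrite nt le_max lexx.
move/le_trans => /(_ _ (hC t)); rewrite nt.
have := @weight_le m t; rewrite nt => /(_ t1) hw.
move/le_trans => /(_ _ (ler_wpM2l C0 hw)).
rewrite qE exprD mulrCA [C * _]mulrA [_ * t ^+ m]mulrC ler_pM2l ?exprn_gt0 //.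
apply/negP; rewrite -ltNge.
have ht : C * 2 ^+ m / c + 1 <= t by rewrite le_max lexx orbT.
have : C * 2 ^+ m < c * t.
  have : C * 2 ^+ m / c < t by apply: lt_le_trans ht; rewrite ltrDl.
  by rewrite ltr_pdivrMr // [t * c]mulrC.
move/lt_le_trans; apply; rewrite ler_pM2l // exprS ler_peMr ?exprn_ege1 //.
exact: ltW.
Qed.

End PolynomialGrowth.

(** * Weighted homogeneous polynomials in two variables *)

Section WeightedPolynomials.
Variable R : realType.
Implicit Types (F : {poly {poly R}}).

(** The monomials of an [r / s]-quasihomogeneous polynomial of degree [d] lie
    on the line [i + (r / s) * j = d]; clearing the denominator keeps everything
    in natural numbers. *)
Definition weighted (r s d : nat) F : Prop :=
  forall i j, F`_i`_j != 0 -> (s * i + r * j = s * d)%N.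

Lemma horner2E F x y :
  F.[x, y] = \sum_(i < size F) \sum_(j < size F`_i) F`_i`_j * (x ^+ i * y ^+ j).
Proof.
rewrite [F.[_]]horner_coef horner_sum; apply: eq_bigr => i _.
rewrite hornerM -rmorphXn hornerC horner_coef mulr_suml.
by apply: eq_bigr => j _; rewrite -mulrA [y ^+ _ * _]mulrC.
Qed.

(** All symmetries of a weighted homogeneous polynomial come from a
    substitution that multiplies each of its monomials by the same factor. *)
Lemma horner2_scale F (x y x' y' c : R) :
  (forall i j, F`_i`_j != 0 -> x' ^+ i * y' ^+ j = c * (x ^+ i * y ^+ j)) ->
  F.[x', y'] = c * F.[x, y].
Proof.
move=> h; rewrite !horner2E mulr_sumr; apply: eq_bigr => i _.
rewrite mulr_sumr; apply: eq_bigr => j _.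
have [->|/h ->] := eqVneq (F`_i`_j) 0; first by rewrite !mul0r mulr0.
by rewrite mulrCA.
Qed.

Lemma scaleXY_coef (t u : R) F i j :
  (scaleXY t u F)`_i`_j = t ^+ i * u ^+ j * F`_i`_j.
Proof.
rewrite /scaleXY.
have compZX (A : comNzRingType) (c : A) (p : {poly A}) k :
    (p \Po (c *: 'X))`_k = c ^+ k * p`_k.
  rewrite coef_comp_poly; under eq_bigr => l _ do rewrite exprZn coefZ coefXn.
  case: (ltnP k (size p)) => kp.
    rewrite (bigD1 (Ordinal kp)) //= eqxx mulr1 mulrC big1 ?addr0 // => l.
    by move=> /negbTE lk; rewrite eq_sym -[k]/(val (Ordinal kp)) val_eqE lk !mulr0.
  rewrite [p`_k]nth_default // mulr0 big1 // => l _.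
  by rewrite gtn_eqF ?mulr0 // (leq_trans (ltn_ord l)).
rewrite compZX -rmorphXn -mulrA mulrC coefMC mulrC; congr (_ * _).
by rewrite coef_map_id0 ?comp_poly0 // compZX.
Qed.

(** Compare coefficients in the functional equation at [t = 2] and take
    logarithms. *)
Lemma quasihomogeneous_weighted (r s d : nat) F : (0 < s)%N ->
  quasihomogeneous (r%:R / s%:R) d F -> weighted r s d F.
Proof.
move=> s0 [_ hF] i j Fij.
have s0' : s%:R != 0 :> R by rewrite pnatr_eq0 -lt0n.
have /(congr1 (fun H : {poly {poly R}} => H`_i`_j)) := hF 2 (ltr0Sn _ 1).
rewrite scaleXY_coef coefZ coefCM => /(mulIf Fij).
rewrite -!powR_mulrn ?powR_ge0 // -powRrM -powRD ?pnatr_eq0 ?implybT //.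
move/(congr1 (@ln R)); rewrite !ln_powR => /mulIf h.
have {}h := h (lt0r_neq0 (ln_gt0 (ltr1n R 2))).
apply/eqP; rewrite -(eqr_nat R) natrD !natrM -h; apply/eqP.
by field.
Qed.

Lemma weighted_scale (r s d : nat) F (x y z : R) : (0 < s)%N ->
  weighted r s d F -> 0 < x ->
  F.[x * z, x `^ (r%:R / s%:R) * y] = x ^+ d * F.[z, y].
Proof.
move=> s0 wF x0; apply: horner2_scale => i j /wF ij.
rewrite !exprMn mulrACA; congr (_ * _).
have s0' : s%:R != 0 :> R by rewrite pnatr_eq0 -lt0n.
rewrite -!powR_mulrn ?powR_ge0 ?ltW // -powRrM -powRD ?(gt_eqF x0) ?implybT //.
congr (_ `^ _); apply: (mulfI s0').
have := congr1 (fun n => n%:R : R) ij; rewrite natrD !natrM => <-.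
by field.
Qed.

(** The exponents satisfy [i + r * j = d] modulo 2 when [s] is odd. *)
Lemma weighted_odd_symm (r s d : nat) F (x y : R) : odd s ->
  weighted r s d F -> F.[- x, (-1) ^+ r * y] = (-1) ^+ d * F.[x, y].
Proof.
move=> os wF; apply: horner2_scale => i j /wF ij.
rewrite -[- x]mulN1r !exprMn mulrACA; congr (_ * _).
have par : odd (i + r * j) = odd d.
  by have := congr1 odd ij; rewrite !oddD !oddM os.
by rewrite -exprM -exprD -[LHS]signr_odd par signr_odd.
Qed.

(** If [s] is even then [r] is odd by coprimality, and the weight equation
    forces every exponent of [Y] to be even. *)
Lemma weighted_even_symm (r s d : nat) F (x y : R) : coprime r s -> ~~ odd s ->
  weighted r s d F -> F.[x, - y] = F.[x, y].
Proof.
move=> co es wF; rewrite -[RHS]mul1r; apply: horner2_scale => i j /wF ij.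
have or : odd r.
  apply/negPn/negP => er; move: co; rewrite /coprime => /eqP co.
  have : (2 %| gcdn r s)%N by rewrite dvdn_gcd !dvdn2 er es.
  by rewrite co.
rewrite mul1r exprNn -signr_odd.
have := congr1 odd ij; rewrite !oddD !oddM (negbTE es) or /= => ->.
by rewrite expr0 mul1r.
Qed.

(** Each power of [Y] occurs with exactly one power of [X], so on a line
    [X = x] with [x != 0] the leading coefficient is a monomial in [x] and the
    degree does not depend on [x].  If [X] is not a factor, then [F] contains a
    pure power of [Y], which is necessarily the term of highest degree in [Y]. *)
Lemma weighted_leading (r s d : nat) F : (0 < s)%N -> (0 < r)%N ->
  weighted r s d F -> F != 0 -> ~ (exists c : R, F = c%:P *: 'X^d) ->
  exists n e (a : R), [/\ a != 0, (0 < n)%N, (s * e + r * n = s * d)%N,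
    forall x, x != 0 ->
      size F.[x%:P] = n.+1 /\ lead_coef F.[x%:P] = a * x ^+ e &
    ~ has_factor_X F -> e = 0%N].
Proof.
move=> s0 r0 wF F0 ncXd.
have coefF i j : F`_i`_j != 0 -> (i < size F)%N.
  by rewrite ltnNge; apply: contra => ?; rewrite [F`_i]nth_default ?coef0.
pose P j := [exists i : 'I_(size F), F`_i`_j != 0].
have PP i j : F`_i`_j != 0 -> P j.
  by move=> ij; apply/existsP; exists (Ordinal (coefF _ _ ij)).
have exP : exists j, P j.
  exists (size (lead_coef F)).-1; apply: (PP (size F).-1).
  by rewrite -!lead_coefE !lead_coef_eq0.
have ubP j : P j -> (j <= s * d)%N.
  by move=> /existsP [i /wF <-]; rewrite (leq_trans _ (leq_addl _ _)) // leq_pmull.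
case: (ex_maxnP exP ubP) => n /existsP [[e eF] /= Fen] nmax.
have wen := wF _ _ Fen.
have coefFx x j : F.[x%:P]`_j = \sum_(i < size F) F`_i`_j * x ^+ i.
  rewrite horner_coef coef_sum; apply: eq_bigr => i _.
  by rewrite -rmorphXn coefMC.
exists n, e, F`_e`_n; split => //.
- rewrite lt0n; apply/eqP => n0; subst n; apply: ncXd; exists F`_d`_0.
  have ij0 i j : F`_i`_j != 0 -> i = d /\ j = 0%N.
    move=> h; have := wF _ _ h; have := nmax _ (PP _ _ h).
    rewrite leqn0 => /eqP -> /eqP; rewrite muln0 addn0 eqn_pmul2l // => /eqP ->.
    by [].
  apply/polyP => i; rewrite coefZ coefXn; apply/polyP => j.
  rewrite coefCM; have [->|id] := eqVneq i d.
    rewrite coef1 mulr_natr; case: j => [//|j]; apply/eqP/negPn/negP => /ij0 [].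
    by [].
  rewrite mulr0n coef0 mulr0; apply/eqP/negPn/negP => /ij0 [id' _].
  by rewrite id' eqxx in id.
- move=> x x0.
  have cn : F.[x%:P]`_n = F`_e`_n * x ^+ e.
    rewrite coefFx (bigD1 (Ordinal eF)) //= big1 ?addr0 // => i.
    move=> ie; have [->|/wF] := eqVneq (F`_i`_n) 0; first by rewrite mul0r.
    rewrite -wen => /eqP; rewrite eqn_add2r eqn_pmul2l // => /eqP ie'.
    by case/negP: ie; apply/eqP/val_inj.
  have cn0 : F.[x%:P]`_n != 0 by rewrite cn mulf_neq0 // expf_neq0.
  have sz : size F.[x%:P] = n.+1.
    apply/eqP; rewrite eqn_leq; apply/andP; split; last first.
      by rewrite ltnNge; apply: contra cn0 => ?; rewrite nth_default.
    apply/leq_sizeP => j nj; rewrite coefFx big1 // => i _.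
    have [->|/PP /nmax] := eqVneq (F`_i`_j) 0; first by rewrite mul0r.
    by rewrite leqNgt nj.
  by rewrite lead_coefE sz.
- move=> noX; have F00 : F`_0 != 0.
    apply/eqP => h; apply: noX; exists (\poly_(i < (size F).-1) F`_i.+1).
    apply/polyP => i; rewrite coefXM coef_poly; case: i => [//|i] /=.
    case: ltnP => //; rewrite -ltnS => hi.
    by rewrite nth_default // (leq_trans (leqSpred _) hi).
  have h : F`_0`_(size F`_0).-1 != 0 by rewrite -lead_coefE lead_coef_eq0.
  have := wF _ _ h; rewrite muln0 add0n => h2.
  have := nmax _ (PP _ _ h); rewrite -(leq_pmul2l r0) h2 -wen.
  rewrite addnC -{2}[(r * n)%N]addn0 leq_add2l leqn0 muln_eq0.
  by rewrite (gtn_eqF s0) => /eqP.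
Qed.

End WeightedPolynomials.

(** * Bi-Lipschitz diffeomorphisms of the line matching two polynomials *)

Section SideMaps.
Variable R : realType.
Implicit Types (psi phi : R -> R) (P Q : {poly R}).

Definition bilipschitz_diffeo psi : Prop :=
  [/\ bijective psi,
      exists2 K : R, 0 < K &
        forall x y, K^-1 * `|x - y| <= `|psi x - psi y| <= K * `|x - y| &
      forall t, derivable psi t 1].

Lemma bilipschitz_diffeo_of_nash (phi : R -> R) :
  nash_diffeomorphism phi -> bilipschitz_on [set: R^o] (phi : R^o -> R^o) ->
  bilipschitz_diffeo phi.
Proof.
move=> [[_ der] [g [fg gf _]]] [K K0 hK]; split; first by exists g.
  by exists K => // x y; exact: hK.
by move=> t; exact: (der 0%N t).
Qed.

Lemma bilipschitz_diffeo_scale (k k' : R) psi : k != 0 -> k' != 0 ->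
  bilipschitz_diffeo psi -> bilipschitz_diffeo (fun t => k * psi (k' * t)).
Proof.
move=> k0 k'0 [[chi psiK chiK] [K K0 hK] dpsi]; split.
- exists (fun w => k'^-1 * chi (k^-1 * w)) => x; first by rewrite mulKf // psiK mulKf.
  by rewrite mulVKf // chiK mulVKf.
- have a0 : 0 < `|k| * `|k'| by rewrite mulr_gt0 ?normr_gt0.
  exists (K * (`|k| * `|k'|) + K * (`|k| * `|k'|)^-1).
    by rewrite addr_gt0 // mulr_gt0 // invr_gt0.
  move=> x y; rewrite -mulrBr normrM.
  have /andP [h1 h2] := hK (k' * x) (k' * y).
  rewrite -mulrBr normrM in h1 h2.
  set N := `|x - y| in h1 h2 *; have N0 : 0 <= N by rewrite normr_ge0.
  have b0 : 0 < (`|k| * `|k'|)^-1 by rewrite invr_gt0.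
  apply/andP; split; last first.
    apply: le_trans (ler_wpM2l (normr_ge0 k) h2) _.
    rewrite (_ : _ * (K * _) = K * (`|k| * `|k'|) * N); last by ring.
    by rewrite ler_wpM2r // lerDl ltW ?mulr_gt0.
  apply: le_trans (ler_wpM2l (normr_ge0 k) h1).
  rewrite (_ : _ * (_ * (_ * N)) = (K * (`|k| * `|k'|)^-1)^-1 * N); last first.
    by rewrite invfM invrK; ring.
  rewrite ler_wpM2r // lef_pV2 ?posrE ?addr_gt0 ?(mulr_gt0 K0) //.
  by rewrite lerDr ltW // mulr_gt0.
- move=> t; apply: derivableM; first exact: derivable_cst.
  have : is_derive t 1 (psi \o ( *%R k')) ('D_1 psi (k' * t) * k').
    apply: is_derive1_comp; first exact: derivableP.
    have -> : *%R k' = k' *: (id : R -> R) by apply/funext.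
    by apply: trigger_derive; rewrite /GRing.scale /= mulr1.
  by case.
Qed.

Lemma derive_lip_bound psi (K t : R) :
  (forall x y, `|psi x - psi y| <= K * `|x - y|) -> derivable psi t 1 ->
  `|'D_1 psi t| <= K.
Proof.
move=> hK dpsi; rewrite /derive.
have cv : cvg ((fun h => h^-1 *: (psi (h *: 1 + t) - psi t)) @ 0^').
  by move: dpsi; rewrite /derivable; apply: cvg_trans.
rewrite -lim_norm //; apply: limr_le; first exact: is_cvg_norm.
near=> h.
rewrite normrM normfV ler_pdivrMl; last first.
  by rewrite normr_gt0; near: h; exact: nbhs_dnbhs_neq.
apply: (le_trans (hK _ _)).
by rewrite addrK /GRing.scale /= mulr1 mulrC.
Unshelve. all: by end_near.
Qed.

(** A continuous injective map of the line is monotone; [delta] records the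
    direction, so that both cases are treated at once. *)
Lemma bilipschitz_diffeo_mono psi : bilipschitz_diffeo psi ->
  exists2 delta : R, delta = 1 \/ delta = -1 &
    forall x y, (delta * x < delta * y) = (psi x < psi y).
Proof.
move=> [/bij_inj inj _ dpsi].
have ctn : {within [set` `]-oo, +oo[%R], continuous psi}.
  apply: continuous_subspaceT => x.
  exact/differentiable_continuous/derivable1_diffP.
have inj' : {in `]-oo, +oo[%R &, injective psi} by move=> x y _ _; exact: inj.
have [h|h] := itv_continuous_inj_mono ctn inj'.
  exists 1; first by left.
  by move=> x y; rewrite !mul1r (leW_mono_in (le_mono_in h)) ?in_itv.
exists (-1); first by right.
by move=> x y; rewrite !mulN1r ltrN2 (leW_nmono_in (le_nmono_in h)) ?in_itv.
Qed.


Lemma lipschitz_weight (f : R -> R) (K : R) : 0 < K ->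
  (forall x y, `|f x - f y| <= K * `|x - y|) ->
  exists2 L : R, 0 < L & forall t, 1 + `|f t| <= L * (1 + `|t|).
Proof.
move=> K0 hf; exists (1 + `|f 0| + K); first by rewrite ltr_pwDr // addr_ge0.
move=> t; have := hf t 0; rewrite subr0 => h.
have : `|f t| <= `|f t - f 0| + `|f 0| by rewrite -{1}(subrK (f 0) (f t)) ler_normD.
have := normr_ge0 (f 0); have := normr_ge0 t.
set a := `|f t - f 0| in h *; set b := `|f 0|; set c := `|t| in h *.
nra.
Qed.

(** Euler's identity [t p' = k p] holds for [p] homogeneous of degree [k]; for a
    polynomial of degree [k] the leading terms cancel. *)
Lemma euler_defect (p : {poly R}) k : size p = k.+2 ->
  exists2 C : R, 0 < C &
    forall t, `|t * p^`().[t] - k.+1%:R * p.[t]| <= C * (1 + `|t|) ^+ k.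
Proof.
move=> szp; pose q := 'X * p^`() - k.+1%:R *: p.
have szq : (size q <= k.+1)%N.
  apply/leq_sizeP => j; rewrite /q coefB coefXM coefZ coef_deriv.
  case: j => [//|j] kj /=; rewrite leq_eqVlt in kj.
  case/predU1P : kj => [[->]|kj]; first by rewrite mulr_natl subrr.
  by rewrite nth_default ?szp // mul0rn mulr0 subr0.
have [C C0 hC] := poly_growth_ub szq; exists C => // t.
by have := hC t; rewrite /q hornerD hornerN hornerZ hornerM hornerX.
Qed.

Lemma subrX_lb (x y : R) k : 0 <= x -> 0 <= y ->
  `|x - y| * y ^+ k <= `|x ^+ k.+1 - y ^+ k.+1|.
Proof.
move=> x0 y0; rewrite subrXX normrM ler_wpM2l // big_ord_recr /= subnn mul1r.
apply: le_trans (ler_norm _).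
by rewrite lerDr sumr_ge0 // => i _; rewrite mulr_ge0 // exprn_ge0.
Qed.

Section MatchedHeights.
Variables (psi : R -> R) (P Q : {poly R}) (n m : nat).
Hypothesis psi_diffeo : bilipschitz_diffeo psi.
Hypothesis P_psi : forall t, P.[psi t] = Q.[t].
Hypotheses (size_P : size P = n.+1) (size_Q : size Q = m.+1).

(** Both [psi] and its inverse grow at most linearly, so composing with them
    preserves the order of growth. *)
Lemma matched_degrees : m = n.
Proof.
have [[chi psiK chiK] [K K0 hK] _] := psi_diffeo.
have lip_psi x y : `|psi x - psi y| <= K * `|x - y| by have /andP[] := hK x y.
have lip_chi x y : `|chi x - chi y| <= K * `|x - y|.
  have /andP[+ _] := hK (chi x) (chi y).
  by rewrite !chiK -ler_pdivlMl ?invr_gt0 // invrK.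
have le_deg (f : R -> R) (A B : {poly R}) k l :
    (forall x y, `|f x - f y| <= K * `|x - y|) ->
    (forall t, A.[f t] = B.[t]) -> size A = k.+1 -> size B = l.+1 -> (l <= k)%N.
  move=> lipf AB szA szB; rewrite -ltnS -szB.
  have [L L0 hL] := lipschitz_weight K0 lipf.
  have [C C0 hC] : exists2 C : R, 0 < C & forall t, `|A.[t]| <= C * (1 + `|t|) ^+ k.
    by apply: poly_growth_ub; rewrite szA.
  apply: (@poly_growth_size _ _ _ (C * L ^+ k)).
    by rewrite mulr_ge0 ?exprn_ge0 // ltW.
  move=> t; rewrite -AB; apply: le_trans (hC _) _.
  rewrite -mulrA -exprMn; apply: ler_wpM2l; first exact: ltW.
  by apply: lerXn2r; rewrite ?nnegrE ?mulr_ge0 ?addr_ge0 // ltW.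
apply/eqP; rewrite eqn_leq (le_deg psi P Q) // (le_deg chi Q P) // => t.
by rewrite -P_psi chiK.
Qed.

(** The quantity is the derivative of [a |-> a * psi (y / a)] at [y / a = t].
    Since [P' (psi t) * psi' t = Q' t], its product with [P' (psi t)] is the
    difference of the Euler defects of [P] at [psi t] and of [Q] at [t], which
    is [O (`|t| ^+ (n - 1))]; dividing by [P' (psi t)] is harmless far from the
    origin, and near the origin the Lipschitz bound for [psi] suffices. *)
Lemma slope_bounded : (0 < n)%N ->
  exists2 C : R, 0 < C & forall t, `|psi t - t * 'D_1 psi t| <= C.
Proof.
have mn := matched_degrees; have szQ := size_Q; rewrite mn in szQ.
have szP := size_P.
case: n szP szQ => [//|k] szP szQ _.
have [_ [K K0 hK] dpsi] := psi_diffeo.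
have lip_psi x y : `|psi x - psi y| <= K * `|x - y| by have /andP[] := hK x y.
have [L L0 hL] := lipschitz_weight K0 lip_psi.
have [Cp Cp0 hp] := euler_defect szP.
have [Cq Cq0 hq] := euler_defect szQ.
have szP' : size P^`() = k.+1 by rewrite polyorder.size_deriv szP.
have [c [T [c0 T1 hT]]] := poly_growth_lb szP'.
have chain t : P^`().[psi t] * 'D_1 psi t = Q^`().[t].
  have h1 : is_derive t 1 (horner P \o psi) (P^`().[psi t] * 'D_1 psi t).
    by apply: is_derive1_comp; exact: derivableP.
  have e : horner P \o psi = horner Q by apply/funext => u /=; rewrite P_psi.
  by move: h1; rewrite e => -[_ <-]; rewrite -derive1E -derivE.
(* [c], [T] bound [P'] from below; [Cfar] then comes from the bound on the
   product, with [1 + `|t| <= 2 * `|t|] and [`|t| <= 2 * K * `|psi t|]. *)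
pose b := `|psi 0|.
(* Beyond [T'], [psi] is at least [T] and at least half of its expected size. *)
pose T' := 1 + 2 * K * (T + b).
pose Cfar := (Cp * L ^+ k + Cq) * (2 ^+ k) * (2 * K) ^+ k / c.
pose Cnear := L * (1 + T') + T' * K.
have b0 : 0 <= b by rewrite /b.
have T0 : 0 < T by apply: lt_le_trans T1.
have KTb0 : 0 < 2 * K * (T + b) by rewrite mulr_gt0 // ?mulr_gt0 // ltr_pwDl.
have T'0 : 0 < T' by rewrite addr_gt0.
have Cn0 : 0 < Cnear by rewrite /Cnear addr_gt0 // mulr_gt0 // addr_gt0.
have Cf0 : 0 < Cfar.
  have L'0 : 0 < L ^+ k by rewrite exprn_gt0.
  have K'0 : 0 < 2 * K by rewrite mulr_gt0.
  by rewrite /Cfar divr_gt0 // mulr_gt0 ?exprn_gt0 // mulr_gt0 ?exprn_gt0 // addr_gt0 // mulr_gt0.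
exists (Cnear + Cfar + 1); first by rewrite addr_gt0 // addr_gt0.
move=> t; have [tT|Tt] := leP `|t| T'.
  have : `|psi t| <= L * (1 + T').
    have := hL t; have : L * (1 + `|t|) <= L * (1 + T') by rewrite ler_pM2l // lerD2l.
    have := normr_ge0 (psi t); lra.
  have : `|t * 'D_1 psi t| <= T' * K.
    by rewrite normrM ler_pM // (derive_lip_bound lip_psi).
  have := ler_normB (psi t) (t * 'D_1 psi t); rewrite /Cnear; lra.
suff : `|psi t - t * 'D_1 psi t| <= Cfar by lra.
have psi_far : `|t| / K <= `|psi t| + b.
  have /andP [h _] := hK t 0; rewrite subr0 mulrC in h.
  exact: le_trans h (ler_normB _ _).
have hTb : 2 * (T + b) < `|t| / K.
  by rewrite ltr_pdivlMr // mulrAC; move: Tt; rewrite /T'; lra.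
have ht1 : 1 <= `|t| by move: Tt; rewrite /T'; lra.
have half : `|t| / (2 * K) = `|t| / K / 2 by field; rewrite gt_eqF.
have hpsi : `|t| / (2 * K) <= `|psi t| by rewrite half; lra.
have hpsiT : T <= `|psi t| by lra.
(* the terms [n * P (psi t)] and [n * Q t] cancel *)
have id : (psi t - t * 'D_1 psi t) * P^`().[psi t] =
    (psi t * P^`().[psi t] - k.+1%:R * P.[psi t])
    - (t * Q^`().[t] - k.+1%:R * Q.[t]).
  by rewrite P_psi -chain; ring.
have := hT _ hpsiT.
have ub : `|(psi t - t * 'D_1 psi t) * P^`().[psi t]| <=
   (Cp * L ^+ k + Cq) * (1 + `|t|) ^+ k.
  rewrite id (le_trans (ler_normB _ _)) // mulrDl lerD //.
  apply: le_trans (hp _) _; rewrite -mulrA -exprMn; apply: ler_wpM2l; first exact: ltW.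
  by apply: lerXn2r; rewrite ?nnegrE ?mulr_ge0 ?addr_ge0 // ltW.
set E := psi t - _ in ub *; rewrite normrM in ub.
set D := `|P^`().[psi t]| in ub *.
move=> hD; set A := Cp * _ + _ in ub *.
have A0 : 0 < A by rewrite addr_gt0 ?mulr_gt0 ?exprn_gt0.
have h2 : c * (`|t| / (2 * K)) ^+ k <= D.
  apply: le_trans hD; rewrite ler_pM2l //.
  by apply: lerXn2r; rewrite ?nnegrE ?divr_ge0 ?mulr_ge0 // ltW.
have tk : 0 < `|t| ^+ k by rewrite exprn_gt0 // (lt_le_trans _ ht1).
have h3 : `|E| * (c * (`|t| / (2 * K)) ^+ k) <= A * (2 ^+ k * `|t| ^+ k).
  apply: le_trans (ler_wpM2l (normr_ge0 E) h2) _; apply: (le_trans ub).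
  by rewrite ler_pM2l // weight_le.
have Kk : 0 < (2 * K) ^+ k by rewrite exprn_gt0 ?mulr_gt0.
have {}h3 : `|E| * c / (2 * K) ^+ k * `|t| ^+ k <= A * 2 ^+ k * `|t| ^+ k.
  by move: h3; rewrite expr_div_n !mulrA -[X in X <= _]mulrA [_ * (2 * K) ^- k]mulrC !mulrA.
by move: h3; rewrite ler_pM2r // ler_pdivrMr // /Cfar -/A ler_pdivlMr.
Qed.

(** Comparing the leading terms of [P (psi t) = Q t] gives
    [`|psi t| ^+ n = (mu * `|t|) ^+ n + O (`|t| ^+ (n - 1))]; taking [n]-th roots
    bounds [`|psi t| - mu * `|t|], and monotonicity decides the signs far from
    the zero of [psi]. *)
Lemma asymptotic_slope (delta mu : R) : (0 < n)%N ->
  delta = 1 \/ delta = -1 ->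
  (forall x y, (delta * x < delta * y) = (psi x < psi y)) ->
  0 < mu -> `|lead_coef P| * mu ^+ n = `|lead_coef Q| ->
  exists2 C : R, 0 < C & forall t, `|psi t - delta * mu * t| <= C.
Proof.
have mn := matched_degrees; have szQ := size_Q; rewrite mn in szQ.
have szP := size_P.
case: n szP szQ => [//|k] szP szQ _ hdelta mono mu0 lead.
have [[chi psiK chiK] [K K0 hK] dpsi] := psi_diffeo.
have lip_psi x y : `|psi x - psi y| <= K * `|x - y| by have /andP[] := hK x y.
have [L L0 hL] := lipschitz_weight K0 lip_psi.
have [Cp Cp0 hp] := poly_growth_ub (poly_sub_lead szP).
have [Cq Cq0 hq] := poly_growth_ub (poly_sub_lead szQ).
have b0 : 0 < `|lead_coef P| by rewrite normr_gt0 lead_coef_eq0 -size_poly_eq0 szP.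
pose A := Cp * L ^+ k + Cq.
have A0 : 0 < A by rewrite addr_gt0 // mulr_gt0 // exprn_gt0.
have near_pow t : `|lead_coef P| * `| `|psi t| ^+ k.+1 - (mu * `|t|) ^+ k.+1 |
    <= A * (1 + `|t|) ^+ k.
  rewrite -[X in X * _ <= _]normr_id -normrM mulrBr exprMn mulrA lead -!normrX -!normrM.
  apply: le_trans (ler_dist_dist _ _) _.
  have -> : lead_coef P * psi t ^+ k.+1 - lead_coef Q * t ^+ k.+1 =
      (Q - lead_coef Q *: 'X^(k.+1)).[t] - (P - lead_coef P *: 'X^(k.+1)).[psi t].
    by rewrite !hornerE P_psi; ring.
  rewrite (le_trans (ler_normB _ _)) // addrC /A mulrDl lerD //.
  apply: le_trans (hp _) _; rewrite -mulrA -exprMn; apply: ler_wpM2l; first exact: ltW.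
  by apply: lerXn2r; rewrite ?nnegrE ?mulr_ge0 ?addr_ge0 // ltW.
pose Cfar := A * 2 ^+ k / (`|lead_coef P| * mu ^+ k).
have Bmu : 0 < `|lead_coef P| * mu ^+ k by rewrite mulr_gt0 // exprn_gt0.
have Cf0 : 0 < Cfar by rewrite divr_gt0 // mulr_gt0 // exprn_gt0.
have far t : 1 <= `|t| -> `| `|psi t| - mu * `|t| | <= Cfar.
  move=> t1; have tk : 0 < `|t| ^+ k by rewrite exprn_gt0 // (lt_le_trans _ t1).
  have mt0 : 0 <= mu * `|t| by rewrite mulr_ge0 // ltW.
  have h := le_trans (ler_wpM2l (ltW b0) (subrX_lb k (normr_ge0 (psi t)) mt0)) (near_pow t).
  have := le_trans h (ler_wpM2l (ltW A0) (weight_le k t1)).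
  rewrite exprMn mulrCA !mulrA ler_pM2r // /Cfar ler_pdivlMr //.
  by rewrite -!mulrA.
pose T := 1 + `|chi 0|.
have T0 : 0 < T by rewrite ltr_pwDl.
exists (Cfar + (L * (1 + T) + mu * T)).
  by rewrite addr_gt0 // addr_gt0 // mulr_gt0 // addr_gt0.
have ndelta : `|delta| = 1 by case: hdelta => ->; rewrite ?normrN normr1.
move=> t; have [tT|Tt] := leP `|t| T.
  apply: (le_trans (ler_normB _ _)); apply: ler_wpDl; first exact: ltW.
  rewrite !normrM ndelta mul1r (gtr0_norm mu0) lerD // ?ler_pM2l //.
  have : L * (1 + `|t|) <= L * (1 + T) by rewrite ler_pM2l // lerD2l.
  have := hL t; lra.
apply: ler_wpDr; first by rewrite addr_ge0 // mulr_ge0 ?addr_ge0 // ltW.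
have norm_eq_le (u v : R) : u = v -> `|u| <= `|v| by move=> ->.
have t1 : 1 <= `|t| by apply: le_trans (ltW Tt); rewrite lerDl.
apply: le_trans (far t t1).
have {Tt} : `|chi 0| < `|t| by apply: lt_trans Tt; rewrite ltrDr.
have := ler_norm (chi 0); have := ler_normr; have := mono t (chi 0); have := mono (chi 0) t.
have := lerNnormlW (lexx `|chi 0|).
rewrite chiK; case: hdelta => ->; rewrite ?mul1r ?mulN1r ?ltrN2 => h1 h2 h3 h4 h5 h6.
- have [t0|t0] := ltP 0 t.
    rewrite (gtr0_norm t0) in h6 *.
    have : 0 < psi t by rewrite -h2; lra.
    by move=> /gtr0_norm ->.
  rewrite (ler0_norm t0) in h6 *.
  have : psi t < 0 by rewrite -h3; lra.
  by move=> /ltr0_norm ->; rewrite -[X in X <= _]normrN; apply: norm_eq_le; ring.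
- have [t0|t0] := ltP 0 t.
    rewrite (gtr0_norm t0) in h6 *.
    have : psi t < 0 by rewrite -h3; lra.
    by move=> /ltr0_norm ->; rewrite -[X in X <= _]normrN; apply: norm_eq_le; ring.
  rewrite (ler0_norm t0) in h6 *.
  have : 0 < psi t by rewrite -h2; lra.
  by move=> /gtr0_norm ->; apply: norm_eq_le; ring.
Qed.

End MatchedHeights.

(** The mean value theorem for [u |-> u * psi (y / u)]. *)
Lemma slope_lipschitz psi (C : R) : (forall t, derivable psi t 1) ->
  (forall t, `|psi t - t * 'D_1 psi t| <= C) ->
  forall a b y : R, 0 < a -> 0 < b ->
    `|a * psi (y / a) - b * psi (y / b)| <= C * `|a - b|.
Proof.
move=> dpsi hC a b y a0 b0; wlog ab : a b a0 b0 / a < b.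
  move=> h; have [ab|ba|->] := ltgtP a b; first exact: h.
    by rewrite distrC [`|a - b|]distrC; exact: h.
  by rewrite !subrr normr0 mulr0.
pose f (u : R) : R := u * psi (y / u).
pose df (u : R) : R := psi (y / u) - y / u * 'D_1 psi (y / u).
have fdf (u : R) : 0 < u -> is_derive u 1 f (df u).
  move=> u0.
  have i1 : is_derive u 1 (fun v : R => y * v^-1) (- (y / u ^+ 2)).
    have h := @is_deriveV R id u 1 1 (lt0r_neq0 u0) (is_derive_id _ _).
    have -> : (fun v : R => y * v^-1) = y *: (fun v : R => (id v)^-1) by apply/funext.
    apply: trigger_derive; rewrite /GRing.scale /=; ring.
  have i2 : is_derive u 1 (psi \o (fun v => y * v^-1)) ('D_1 psi (y / u) * - (y / u ^+ 2)).
    by apply: is_derive1_comp; exact: derivableP.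
  have -> : f = id * (psi \o (fun v => y * v^-1)) by apply/funext.
  apply: trigger_derive; rewrite /GRing.scale /= /df mulr1; field.
  exact: lt0r_neq0.
have [||c] := @MVT _ f df a b ab.
- by move=> u; rewrite in_itv /= => /andP[au _]; apply: fdf; exact: lt_trans au.
- apply: continuous_in_subspaceT => u; rewrite inE /= in_itv /= => /andP[au _].
  apply/differentiable_continuous/derivable1_diffP.
  by have [] := fdf u (lt_le_trans a0 au).
move=> _ e; rewrite distrC -/(f a) -/(f b) e normrM [`|b - a|]distrC ler_wpM2r //.
exact: hC.
Qed.

End SideMaps.

(** * Semialgebraic sets without quantifier elimination *)

Section Semialgebraic.
Variables (R : realType) (n : nat).
Implicit Types (f g x y : 'rV[R]_n -> R) (A B : set 'rV[R]_n).

Definition polynomial_function f : Prop :=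
  exists p : mpoly.mpoly n R, forall v, f v = mpoly.meval (fun i => v ord0 i) p.

Lemma polynomial_coord i : polynomial_function (fun v => v ord0 i).
Proof. by exists (mpoly.mpolyX R (mpoly.mnm1 i)) => v; rewrite mpoly.mevalXU. Qed.

Lemma polynomial_cst c : polynomial_function (fun=> c).
Proof. by exists (mpoly.mpolyC n c) => v; rewrite mpoly.mevalC. Qed.

Lemma polynomialD f g : polynomial_function f -> polynomial_function g ->
  polynomial_function (fun v => f v + g v).
Proof. by move=> [p hp] [q hq]; exists (p + q) => v; rewrite mpoly.mevalD hp hq. Qed.

Lemma polynomialM f g : polynomial_function f -> polynomial_function g ->
  polynomial_function (fun v => f v * g v).
Proof. by move=> [p hp] [q hq]; exists (p * q) => v; rewrite mpoly.mevalM hp hq. Qed.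

Lemma polynomialZ c f : polynomial_function f ->
  polynomial_function (fun v => c * f v).
Proof. exact/polynomialM/polynomial_cst. Qed.

Lemma polynomialN f : polynomial_function f -> polynomial_function (fun v => - f v).
Proof.
move=> hf; have [p hp] := polynomialZ (-1) hf.
by exists p => v; rewrite -hp mulN1r.
Qed.

Lemma polynomialX f k : polynomial_function f ->
  polynomial_function (fun v => f v ^+ k).
Proof.
move=> hf; elim: k => [|k IH]; first exact: (polynomial_cst 1).
have [p hp] := polynomialM hf IH.
by exists p => v; rewrite -hp exprS.
Qed.

Lemma polynomial_sum (I : Type) (r : seq I) (h : I -> 'rV[R]_n -> R) :
  (forall i, polynomial_function (h i)) ->
  polynomial_function (fun v => \sum_(i <- r) h i v).
Proof.
move=> hh; elim: r => [|i r IH].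
  by have [p hp] := polynomial_cst 0; exists p => v; rewrite big_nil (hp v).
have [p hp] := polynomialD (hh i) IH.
by exists p => v; rewrite big_cons -hp.
Qed.

Lemma polynomial_horner2 (F : {poly {poly R}}) f g :
  polynomial_function f -> polynomial_function g ->
  polynomial_function (fun v => F.[f v, g v]).
Proof.
move=> hf hg.
have [p hp] : polynomial_function (fun v =>
    \sum_(i < size F) \sum_(j < size F`_i) F`_i`_j * (f v ^+ i * g v ^+ j)).
  apply: polynomial_sum => i; apply: polynomial_sum => j; apply: polynomialZ.
  by apply: polynomialM; exact: polynomialX.
by exists p => v; rewrite -hp horner2E.
Qed.

Lemma semialgebraic_ext A B : (forall v, A v <-> B v) ->
  semialgebraic A -> semialgebraic B.
Proof. by move=> AB; have -> : A = B by apply/funext => v; apply/propext. Qed.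

Lemma semialgebraic_lt f g : polynomial_function f -> polynomial_function g ->
  semialgebraic [set v | f v < g v].
Proof.
move=> hf hg; have [p hp] := polynomialD hg (polynomialN hf).
apply: semialgebraic_ext (semialgebraic_gt0 p) => v.
by rewrite /= -hp subr_gt0.
Qed.

Lemma semialgebraic_eq f g : polynomial_function f -> polynomial_function g ->
  semialgebraic [set v | f v = g v].
Proof.
move=> hf hg; have [p hp] := polynomialD hf (polynomialN hg).
apply: semialgebraic_ext (semialgebraic_eq0 p) => v.
by rewrite /= -hp; split => [/eqP|->]; rewrite ?subrr // subr_eq0 => /eqP.
Qed.

Lemma semialgebraic_iff A B : semialgebraic A -> semialgebraic B ->
  semialgebraic [set v | A v <-> B v].
Proof.
move=> sA sB; apply: semialgebraic_ext (semialgebraicU (semialgebraicI sA sB)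
  (semialgebraicI (semialgebraicC sA) (semialgebraicC sB))) => v.
rewrite /setU /setI /setC /=; split; first by tauto.
by have := pselect (A v); tauto.
Qed.

Lemma semialgebraic_all (T : eqType) (s : seq T) (S : T -> set 'rV[R]_n) :
  (forall c, semialgebraic (S c)) ->
  semialgebraic [set v | forall c, c \in s -> S c v].
Proof.
move=> hS; elim: s => [|c s IH].
  by apply: semialgebraic_ext (semialgebraic_eq (polynomial_cst 0) (polynomial_cst 0)).
apply: semialgebraic_ext (semialgebraicI (hS c) IH) => v; split => /=.
  by move=> [h1 h2] d; rewrite inE => /predU1P [->|/h2].
move=> h; split; first by apply: h; rewrite inE eqxx.
by move=> d ds; apply: h; rewrite inE ds orbT.
Qed.

Lemma powR_rat_expr (r s : nat) (x : R) : (0 < s)%N ->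
  (x `^ (r%:R / s%:R)) ^+ s = x `^ r%:R.
Proof.
move=> s0; rewrite -powR_mulrn ?powR_ge0 // -powRrM divfK //.
by rewrite pnatr_eq0 -lt0n.
Qed.

(** Where [x > 0], raising to the power [s] turns [c * x ^ (r / s) < y] into a
    polynomial inequality, once the signs of [c] and [y] are known. *)
Lemma semialgebraic_lt_powR (r s : nat) x y (c : R) : (0 < s)%N ->
  polynomial_function x -> polynomial_function y ->
  semialgebraic [set v | 0 < x v /\ c * x v `^ (r%:R / s%:R) < y v].
Proof.
move=> s0 hx hy.
have powE v : 0 < x v -> (x v `^ (r%:R / s%:R)) ^+ s = x v ^+ r.
  by move=> x0; rewrite powR_rat_expr // powR_mulrn // ltW.
have zero := polynomial_cst 0.
have [c0|c0] := leP 0 c.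
  apply: semialgebraic_ext (semialgebraicI (semialgebraic_lt zero hx)
    (semialgebraicI (semialgebraic_lt zero hy)
     (semialgebraic_lt (polynomialZ (c ^+ s) (polynomialX r hx)) (polynomialX s hy)))) => v.
  rewrite /setI /=; split => [[x0 [y0]]|[x0 h]].
    rewrite -powE // -exprMn => h; split=> //.
    by rewrite -(@ltr_pXn2r _ s) // nnegrE ?mulr_ge0 ?powR_ge0 // ltW.
  have ca0 : 0 <= c * x v `^ (r%:R / s%:R) by rewrite mulr_ge0 ?powR_ge0.
  have y0 := le_lt_trans ca0 h; split=> //; split => //.
  by rewrite -powE // -exprMn ltr_pXn2r // nnegrE // ltW.
apply: semialgebraic_ext (semialgebraicI (semialgebraic_lt zero hx)
  (semialgebraicU (semialgebraicC (semialgebraic_lt hy zero))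
   (semialgebraic_lt (polynomialX s (polynomialN hy))
     (polynomialZ ((- c) ^+ s) (polynomialX r hx))))) => v.
rewrite /setI /setU /setC /=.
have [x0|x0] := boolP (0 < x v); last by split=> -[].
have ca0 : 0 < (- c) * x v `^ (r%:R / s%:R) by rewrite mulr_gt0 ?powR_gt0 // oppr_gt0.
rewrite -powE // -exprMn; split => -[_ h]; split => //.
  case: h => [/negP|h]; first by rewrite -leNgt; lra.
  have [y0|y0] := leP 0 (y v); first by lra.
  move: h; rewrite ltr_pXn2r ?nnegrE ?oppr_ge0 ?ltW //; lra.
have [y0|y0] := leP 0 (y v); first by left => y1; lra.
right; rewrite ltr_pXn2r ?nnegrE ?oppr_ge0 ?ltW //; lra.
Qed.

End Semialgebraic.

Section Branch.
Variable R : realType.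

Lemma all_roots (p : {poly R}) : p != 0 ->
  exists s : seq R, forall x, root p x -> x \in s.
Proof.
have [m] := ubnP (size p); elim: m p => [//|m IH] p szp p0.
have [[x px]|nor] := pselect (exists x, root p x); last first.
  by exists [::] => x px; case: nor; exists x.
have [q pE] := factor_theorem p x px.
have q0 : q != 0 by apply: contra_neq p0 => q0; rewrite pE q0 mul0r.
have [|s hs] := IH q _ q0.
  by move: szp; rewrite pE size_Mmonic ?monicXsubC // size_XsubC addn2 ltnS.
exists (x :: s) => y; rewrite pE rootM root_XsubC inE => /orP [/hs ->|->//].
by rewrite orbT.
Qed.

(** Rolle's theorem puts a critical point of [P] strictly between two distinct
    points with the same value; that point separates them. *)
Lemma eq_of_same_branch (P : {poly R}) (s : seq R) (w w' : R) :
  (forall c, root P^`() c -> c \in s) ->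
  P.[w] = P.[w'] -> (forall c, c \in s -> (c < w) = (c < w')) -> w = w'.
Proof.
move=> hs; wlog ww' : w w' / w < w'.
  move=> h e hc; have [l|l|//] := ltgtP w w'; first exact: h.
  by apply/esym/h => // c cs; rewrite hc.
move=> e hc; have [c] := polyrcf.poly_rolle ww' e.
rewrite in_itv /= => /andP [wc cw'] dP0.
have := hc c; rewrite hs; last by apply/eqP.
by rewrite cw' ltNge (ltW wc) => /(_ isT).
Qed.

End Branch.

(** * Coordinates and continuity in the plane *)

Section Plane.
Variable R : realType.

Definition row2 (x y : R) : 'rV[R]_2 := \row_i (if i == ord0 then x else y).

Lemma row2_fst x y : row2 x y ord0 ord0 = x.
Proof. by rewrite mxE. Qed.

Lemma row2_snd x y : row2 x y ord0 ord_max = y.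
Proof. by rewrite mxE. Qed.

Lemma row2_eq (u v : 'rV[R]_2) : u ord0 ord0 = v ord0 ord0 ->
  u ord0 ord_max = v ord0 ord_max -> u = v.
Proof.
move=> h0 h1; apply/rowP; case=> [[|[|//]] hi].
  by rewrite (_ : Ordinal hi = ord0) //; apply/val_inj.
by rewrite (_ : Ordinal hi = ord_max) //; apply/val_inj.
Qed.

Lemma norm_row2 (v : 'rV[R]_2) :
  `|v| = Num.max `|v ord0 ord0| `|v ord0 ord_max|.
Proof.
rewrite /Num.norm /= mx_normrE; apply/le_anti/andP; split.
  apply: bigmax_le => [|[i j] _]; first by rewrite le_max normr_ge0.
  rewrite (ord1 i) /=; case: j => [[|[|//]] hj]; rewrite le_max.
    by rewrite (_ : Ordinal hj = ord0) ?lexx //; apply/val_inj.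
  by rewrite (_ : Ordinal hj = ord_max) ?lexx ?orbT //; apply/val_inj.
rewrite ge_max; apply/andP; split.
  exact: (le_bigmax _ (fun ij : 'I_1 * 'I_2 => `|v ij.1 ij.2|) (ord0, ord0)).
exact: (le_bigmax _ (fun ij : 'I_1 * 'I_2 => `|v ij.1 ij.2|) (ord0, ord_max)).
Qed.

(** Polynomials preserve limits; this extends identities from the complement
    of the vertical axis to the axis. *)
Lemma horner2_continuous (F : {poly {poly R}}) (f g : R -> R) (a : R) :
  f x @[x --> a] --> f a -> g x @[x --> a] --> g a ->
  F.[f x, g x] @[x --> a] --> F.[f a, g a].
Proof.
move=> cf cg; elim/poly_ind: F => [|F c IH].
  rewrite !horner0 (_ : (fun x => _) = cst 0); first exact: cvg_cst.
  by apply/funext => x; rewrite !horner0.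
have hE x : (F * 'X + c%:P).[f x, g x] = F.[f x, g x] * f x + c.[g x].
  by rewrite hornerMXaddC hornerD hornerM hornerC.
rewrite hE (_ : (fun x => _) = fun x => F.[f x, g x] * f x + c.[g x]); last first.
  by apply/funext.
apply: cvgD; first exact: cvgM.
by apply: (cvg_comp _ _ cg); exact: continuous_horner.
Qed.

Lemma linear_bound_continuous (f : R -> R) (C : R) :
  (forall x, `|x| <= 1 -> `|f x - f 0| <= C * `|x|) -> f x @[x --> 0] --> f 0.
Proof.
move=> hf; apply/cvgrPdist_lt => e e0.
have C0 : 0 < `|C| + 1 by rewrite ltr_pwDr.
near=> x; rewrite distrC.
have x1 : `|x| <= 1.
  by rewrite -[x]subr0 distrC; near: x; apply: (@cvgr_dist_le _ _ _ _ (nbhs_filter _)).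
apply: le_lt_trans (hf x x1) _.
have : `|x| < e / (`|C| + 1).
  rewrite -[x]subr0 distrC; near: x; apply: (@cvgr_dist_lt _ _ _ _ (nbhs_filter _)) => //.
  by rewrite divr_gt0.
rewrite ltr_pdivlMr // => h; apply: le_lt_trans h.
have := ler_norm C; have := normr_ge0 x; nra.
Unshelve. all: by end_near.
Qed.

(** With [y = x * u] and [0 <= u <= 1], the difference is
    [x ^ beta * (1 - u ^ beta)], and [x ^ beta <= x] because [beta >= 1], while
    [1 - u ^ beta <= 1 - u ^ r <= r * (1 - u)]. *)
Lemma powR_lipschitz (r s : nat) (x y : R) : (0 < s)%N -> (s < r)%N ->
  0 <= x <= 1 -> 0 <= y <= 1 ->
  `|x `^ (r%:R / s%:R) - y `^ (r%:R / s%:R)| <= r%:R * `|x - y|.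
Proof.
move=> s0 sr; wlog xy : x y / y < x.
  move=> h hx hy; have [l|l|->] := ltgtP x y; last by rewrite !subrr normr0 mulr0.
    by rewrite distrC [`|x - y|]distrC; exact: h.
  exact: h.
move=> /andP [_ x1] /andP [y0 _].
have x0 : 0 < x by apply: le_lt_trans xy.
have s0' : 0 < s%:R :> R by rewrite ltr0n.
set beta := _ / _.
have beta1 : 1 <= beta by rewrite /beta ler_pdivlMr // mul1r ler_nat ltnW.
have betar : beta <= r%:R.
  by rewrite /beta ler_pdivrMr // ler_peMr // ler1n.
have beta0 : 0 <= beta by rewrite (le_trans _ beta1).
have [u [u0 u1 yE]] : exists u, [/\ 0 <= u, u <= 1 & y = x * u].
  exists (y / x); split; first by rewrite divr_ge0 // ltW.
    by rewrite ler_pdivrMr // mul1r ltW.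
  by rewrite mulrC divfK // gt_eqF.
have ybE : y `^ beta = x `^ beta * u `^ beta by rewrite yE powRM // ltW.
have ub1 : u `^ beta <= 1.
  have : u `^ beta <= 1 `^ beta by apply: ge0_ler_powR; rewrite ?nnegrE.
  by rewrite powR1.
rewrite ybE ger0_norm; last by rewrite subr_ge0 ler_piMr ?powR_ge0.
rewrite gtr0_norm ?subr_gt0 //.
have xb : x `^ beta <= x by rewrite -[leRHS](powRr1 (ltW x0)) ger_powR ?x0.
have ub : 1 - u `^ beta <= r%:R * (1 - u).
  apply: (@le_trans _ _ (1 - u ^+ r)).
    rewrite lerD2l lerN2 -powR_mulrn //; have [->|un0] := eqVneq u 0.
      rewrite !powR0 // ?pnatr_eq0; first by rewrite gt_eqF // (lt_le_trans _ beta1).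
      by rewrite -lt0n (leq_ltn_trans _ sr).
    by apply: ger_powR; rewrite // lt_def un0 u0.
  rewrite -{1}(expr1n _ r) subrXX mulrC ler_wpM2r ?subr_ge0 //.
  apply: (@le_trans _ _ (\sum_(i < r) (1 : R))); last by rewrite sumr_const card_ord.
  by apply: ler_sum => i _; rewrite expr1n mul1r exprn_ile1.
rewrite -[X in X - _]mulr1 -mulrBr yE.
apply: le_trans (ler_wpM2l (powR_ge0 _ _) ub) _.
have -> : r%:R * (x - x * u) = x * (r%:R * (1 - u)) by ring.
by rewrite ler_wpM2r // mulr_ge0 // subr_ge0.
Qed.

End Plane.

(** * Gluing two one-sided maps along the vertical axis *)

Section GluedMap.
Variable R : realType.

(** All metric bounds on a one-sided map with a single constant, so that a
    constant common to the two sides is obtained by adding them.  The third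
    bound is the limit case [b = 0] of the fourth, where [b * psi (y / b)] tends
    to [M * y]. *)
Definition controlled (M : R) (psi : R -> R) (K : R) : Prop :=
  [/\ forall x y, `|psi x - psi y| <= K * `|x - y|,
      forall x y, `|x - y| <= K * `|psi x - psi y|,
      forall t, `|psi t - M * t| <= K &
      forall a b y, 0 < a -> 0 < b ->
        `|a * psi (y / a) - b * psi (y / b)| <= K * `|a - b|].

Lemma controlledW M psi K K' : K <= K' -> controlled M psi K -> controlled M psi K'.
Proof.
move=> KK' [h1 h2 h3 h4]; split => [x y|x y|t|a b y a0 b0].
- by apply: le_trans (h1 x y) _; rewrite ler_wpM2r.
- by apply: le_trans (h2 x y) _; rewrite ler_wpM2r.
- exact: le_trans (h3 t) KK'.
- by apply: le_trans (h4 a b y a0 b0) _; rewrite ler_wpM2r.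
Qed.

Definition tame (delta M : R) (psi : R -> R) : Prop :=
  [/\ bijective psi,
      forall x y, (delta * x < delta * y) = (psi x < psi y) &
      exists2 K : R, 0 < K & controlled M psi K].

Definition side_sign (b : bool) : R := if b then 1 else -1.

Variables (r s : nat) (eps delta M : R) (l : bool -> R) (psi : bool -> R -> R).
Hypotheses (s_gt0 : (0 < s)%N) (lt_sr : (s < r)%N).
Hypotheses (eps_sign : eps = 1 \/ eps = -1) (M_neq0 : M != 0).
Hypotheses (l_gt0 : forall b, 0 < l b) (psi_tame : forall b, tame delta M (psi b)).

Local Notation beta := (r%:R / s%:R : R).

(** The homogenization [a * psi (y / a)] of [psi b], extended to [a = 0] by
    its limit. *)
Definition perspective (b : bool) (a y : R) : R :=
  if a == 0 then M * y else a * psi b (y / a).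

Definition glued_fst (x : R) : R := eps * (l (0 < x) * x).

Definition glued_snd (x y : R) : R := perspective (0 < x) (`|x| `^ beta) y.

Definition glued (v : 'rV[R]_2) : 'rV[R]_2 :=
  row2 (glued_fst (v ord0 ord0)) (glued_snd (v ord0 ord0) (v ord0 ord_max)).

Definition strip : set 'rV[R]_2 := [set v | -1 < v ord0 ord0 /\ v ord0 ord0 < 1].

Definition glued_strip : set 'rV[R]_2 :=
  [set u | - l false < eps * u ord0 ord0 /\ eps * u ord0 ord0 < l true].

Lemma beta_gt0 : 0 < beta.
Proof. by rewrite divr_gt0 // ltr0n // (ltn_trans s_gt0). Qed.

Lemma common_control : exists2 K : R, 0 < K & forall b, controlled M (psi b) K.
Proof.
have [_ _ [K1 K10 h1]] := psi_tame true; have [_ _ [K2 K20 h2]] := psi_tame false.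
exists (K1 + K2); first by rewrite addr_gt0.
by case; [apply: controlledW h1|apply: controlledW h2]; rewrite ?lerDl ?lerDr ltW.
Qed.

Lemma eps_eps : eps * eps = 1.
Proof. by case: eps_sign => ->; rewrite ?mulrNN mulr1. Qed.

Lemma norm_eps : `|eps| = 1.
Proof. by case: eps_sign => ->; rewrite ?normrN normr1. Qed.

(** The boundedness of [psi t - M * t] is exactly this inequality with one of
    the two parameters equal to 0. *)
Lemma perspective_lip_a K b a a' y : 0 <= a -> 0 <= a' ->
  controlled M (psi b) K ->
  `|perspective b a y - perspective b a' y| <= K * `|a - a'|.
Proof.
move=> a0 a'0 [_ _ h3 h4]; rewrite /perspective.
have lim0 c : 0 < c -> `|c * psi b (y / c) - M * y| <= K * `|c|.
  move=> c0; have -> : c * psi b (y / c) - M * y = (psi b (y / c) - M * (y / c)) * c.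
    by field; rewrite gt_eqF.
  by rewrite normrM ler_wpM2r.
have [->|an] := eqVneq a 0; have [->|a'n] := eqVneq a' 0.
- by rewrite !subrr normr0 mulr0.
- by rewrite distrC [`|0 - _|]distrC subr0 lim0 // lt_def a'n.
- by rewrite subr0 lim0 // lt_def an.
- by apply: h4; rewrite lt_def ?an ?a'n.
Qed.

Lemma perspective_lip_y K b a y y' : 0 <= a -> controlled M (psi b) K ->
  `|perspective b a y - perspective b a y'| <= (K + `|M|) * `|y - y'|.
Proof.
move=> a0 [h1 _ h3 _]; rewrite /perspective.
have K0 : 0 <= K by apply: le_trans (h3 0).
have [_|an] := eqVneq a 0.
  by rewrite -mulrBr normrM ler_wpM2r // lerDr.
have {an}a0 : 0 < a by rewrite lt_def an.
rewrite -mulrBr normrM (gtr0_norm a0).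
apply: (@le_trans _ _ (K * `|y - y'|)); last by rewrite ler_wpM2r // lerDl.
apply: le_trans (ler_wpM2l (ltW a0) (h1 _ _)) _.
rewrite -mulrBl normrM normfV (gtr0_norm a0).
by rewrite (_ : a * _ = K * `|y - y'|) //; field; rewrite gt_eqF.
Qed.

Lemma perspective_colip_y K b a y y' : 0 <= a -> controlled M (psi b) K ->
  `|y - y'| <= (K + `|M|^-1) * `|perspective b a y - perspective b a y'|.
Proof.
move=> a0 [_ h2 h3 _]; rewrite /perspective.
have K0 : 0 <= K by apply: le_trans (h3 0).
have [_|an] := eqVneq a 0.
  rewrite -mulrBr normrM mulrDl mulKf ?normr_eq0 // lerDr.
  by rewrite mulr_ge0 // mulr_ge0.
have {an}a0 : 0 < a by rewrite lt_def an.
rewrite -mulrBr normrM (gtr0_norm a0).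
apply: (@le_trans _ _ (K * (a * `|psi b (y / a) - psi b (y' / a)|))); last first.
  by rewrite ler_wpM2r ?lerDl ?invr_ge0 // mulr_ge0 // ltW.
have := ler_wpM2l (ltW a0) (h2 (y / a) (y' / a)).
rewrite -mulrBl normrM normfV (gtr0_norm a0) mulrC divfK ?gt_eqF //.
by rewrite mulrCA.
Qed.

(** On one side of the axis this is the Lipschitz property of the
    homogenization composed with that of the power function; points on different
    sides are compared through the axis, where both definitions agree. *)
Lemma glued_snd_lip_x K x x' y : `|x| <= 1 -> `|x'| <= 1 ->
  (forall b, controlled M (psi b) K) ->
  `|glued_snd x y - glued_snd x' y| <= K * r%:R * `|x - x'|.
Proof.
move=> x1 x'1 hK.
have K0 : 0 <= K by have [_ _ h3 _] := hK true; apply: le_trans (h3 0).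
have lip z z' : `|z| <= 1 -> `|z'| <= 1 -> (0 < z) = (0 < z') \/ z' = 0 ->
    `|glued_snd z y - glued_snd z' y| <= K * r%:R * `| `|z| - `|z'| |.
  move=> z1 z'1 hz.
  have -> : glued_snd z' y = perspective (0 < z) (`|z'| `^ beta) y.
    case: hz => [->//|->]; rewrite /glued_snd normr0 powR0 ?gt_eqF ?beta_gt0 //.
    by rewrite /perspective eqxx.
  apply: le_trans (perspective_lip_a _ _ _ (hK _)) _; rewrite ?powR_ge0 //.
  by rewrite -mulrA ler_wpM2l // powR_lipschitz ?normr_ge0.
have [same|diff] := eqVneq (0 < x) (0 < x').
  apply: le_trans (lip x x' x1 x'1 (or_introl same)) _.
  by rewrite ler_wpM2l ?mulr_ge0 // ler_dist_dist.
(* on different sides, both points are compared with the axis *)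
have far : `|x| + `|x'| = `|x - x'|.
  move: diff; case: (ltP 0 x) => hx; case: (ltP 0 x') => hx' // _.
    by rewrite (gtr0_norm hx) (ler0_norm hx') ger0_norm //; lra.
  by rewrite (ler0_norm hx) (gtr0_norm hx') ler0_norm //; lra.
have n0 : `|0 : R| <= 1 by rewrite normr0.
have h1 := lip x 0 x1 n0 (or_intror erefl).
have h2 := lip x' 0 x'1 n0 (or_intror erefl).
rewrite -far mulrDr.
rewrite normr0 subr0 normr_id in h1; rewrite normr0 subr0 normr_id in h2.
apply: le_trans (ler_distD (glued_snd 0 y) _ _) _.
by rewrite lerD // distrC.
Qed.

Lemma glued_fst_bilip x x' :
  Num.min (l true) (l false) * `|x - x'| <= `|glued_fst x - glued_fst x'|
    <= (l true + l false) * `|x - x'|.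
Proof.
rewrite /glued_fst -mulrBr normrM norm_eps mul1r.
have lt := l_gt0 true; have lf := l_gt0 false.
wlog xx' : x x' / x' <= x.
  move=> h; have [|/ltW] := leP x' x; first exact: h.
  by rewrite [`|x - x'|]distrC [`|_ * x - _|]distrC; exact: h.
have ml : Num.min (l true) (l false) <= l true by rewrite ge_min lexx.
have mr : Num.min (l true) (l false) <= l false by rewrite ge_min lexx orbT.
set m := Num.min _ _ in ml mr *.
rewrite (ger0_norm (_ : 0 <= x - x')) ?subr_ge0 //.
have [hx|hx] := ltP 0 x; have [hx'|hx'] := ltP 0 x'.
- rewrite ger0_norm; last by nra.
  by apply/andP; split; nra.
- rewrite ger0_norm; last by nra.
  by apply/andP; split; nra.
- by have := le_lt_trans xx' (le_lt_trans hx hx'); rewrite ltxx.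
- rewrite ger0_norm; last by nra.
  by apply/andP; split; nra.
Qed.

(** The map is triangular.  Its first component is bi-Lipschitz in [x]; the
    second one is bi-Lipschitz in [y] for fixed [x], and its variation in [x] is
    controlled by the variation of the first component.  This gives the lower
    bound without considering the inverse map. *)
Lemma glued_bilipschitz : bilipschitz_on strip glued.
Proof.
have [K K0 hK] := common_control.
set m := Num.min (l true) (l false).
have m0 : 0 < m by rewrite lt_min !l_gt0.
pose B := l true + l false; have B0 : 0 < B by rewrite addr_gt0.
pose K1 := K * r%:R; have K10 : 0 <= K1 by rewrite mulr_ge0 // ltW.
pose K2 := K + `|M|; have K20 : 0 < K2 by rewrite ltr_pwDl.
pose K3 := K + `|M|^-1; have K30 : 0 < K3 by rewrite ltr_pwDl ?invr_ge0.
pose L := (B + K2 + K1) + (m^-1 + K3 * (1 + K1 * m^-1)).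
have mi0 : 0 < m^-1 by rewrite invr_gt0.
have L10 : 0 < B + K2 + K1 by rewrite ltr_pwDl // addr_gt0.
have K4 : 0 < K3 * (1 + K1 * m^-1).
  by rewrite mulr_gt0 // ltr_pwDl // mulr_ge0 // ltW.
have L20 : 0 < m^-1 + K3 * (1 + K1 * m^-1) by rewrite addr_gt0.
have L0 : 0 < L by rewrite addr_gt0.
exists L => // v v' hv hv'.
rewrite !norm_row2 !mxE /=.
move: hv hv'; rewrite /strip /=.
set x := v ord0 ord0; set x' := v' ord0 ord0.
set y := v ord0 ord_max; set y' := v' ord0 ord_max.
move=> [hx1 hx2] [hx'1 hx'2].
have nx : `|x| <= 1 by rewrite ler_norml !ltW.
have nx' : `|x'| <= 1 by rewrite ler_norml !ltW.
have /andP [f1 f2] := glued_fst_bilip x x'.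
have sx yy := glued_snd_lip_x yy nx nx' hK.
have sy := perspective_lip_y y y' (powR_ge0 `|x| beta) (hK (0 < x)).
have sc := perspective_colip_y y y' (powR_ge0 `|x| beta) (hK (0 < x)).
rewrite -/(glued_snd x y) -/(glued_snd x y') -/K2 in sy.
rewrite -/(glued_snd x y) -/(glued_snd x y') -/K3 in sc.
move: f1 f2 sy sc (sx y') => {sx}.
rewrite -/m -/B -/K1.
set df := `|glued_fst x - glued_fst x'|; set dx := `|x - x'|; set dy := `|y - y'|.
set a1 := `|glued_snd x y - glued_snd x y'|; set a2 := `|glued_snd x y' - _|.
set ds := `|glued_snd x y - glued_snd x' y'|.
have tri1 : ds <= a1 + a2 by exact: ler_distD.
have tri2 : a1 <= ds + a2.
  by rewrite /a1 /a2 [`|glued_snd x y' - _|]distrC; exact: ler_distD.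
have dx0 : 0 <= dx by exact: normr_ge0.
have dy0 : 0 <= dy by exact: normr_ge0.
have df0 : 0 <= df by exact: normr_ge0.
have ds0 : 0 <= ds by exact: normr_ge0.
move=> f1 f2 sy sc sx.
have {}sx : a2 <= K1 * dx by exact: sx.
have {}sy : a1 <= K2 * dy by exact: sy.
set D := Num.max dx dy; set E := Num.max df ds.
have Dx : dx <= D by rewrite le_max lexx.
have Dy : dy <= D by rewrite le_max lexx orbT.
have Ef : df <= E by rewrite le_max lexx.
have Es : ds <= E by rewrite le_max lexx orbT.
have D0 : 0 <= D by apply: le_trans Dx.
have E0 : 0 <= E by apply: le_trans Ef.
have dxE : dx <= m^-1 * E.
  by rewrite ler_pdivlMl //; apply: le_trans Ef.
have dyE : dy <= K3 * (1 + K1 * m^-1) * E.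
  apply: le_trans sc _; rewrite -mulrA ler_pM2l //.
  apply: le_trans tri2 _; rewrite mulrDl mul1r lerD //.
  by apply: le_trans sx _; rewrite -mulrA ler_wpM2l.
apply/andP; split.
  rewrite ler_pdivrMl //; rewrite ge_max; apply/andP; split.
    apply: le_trans dxE _; rewrite ler_wpM2r // /L ler_wpDl ?(ltW L10) //.
    by rewrite lerDl ltW.
  apply: le_trans dyE _; rewrite ler_wpM2r // /L ler_wpDl ?(ltW L10) //.
  by rewrite lerDr ltW.
have up : (B + K2 + K1) * D <= L * D by rewrite ler_wpM2r // lerDl ltW.
apply: le_trans up; rewrite (mulrDl (B + K2)) (mulrDl B).
have BD : 0 <= B * D by rewrite mulr_ge0 // ltW.
have K2D : 0 <= K2 * D by rewrite mulr_ge0 // ltW.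
have K1D : 0 <= K1 * D by rewrite mulr_ge0.
rewrite ge_max; apply/andP; split.
  apply: le_trans f2 _; apply: le_trans (ler_wpM2l (ltW B0) Dx) _.
  by rewrite -addrA lerDl addr_ge0.
apply: le_trans tri1 _; rewrite -addrA; apply: ler_wpDl => //; apply: lerD.
  by apply: le_trans sy _; rewrite ler_pM2l.
by apply: le_trans sx _; rewrite ler_wpM2l.
Qed.

Lemma strip_open : open strip.
Proof.
rewrite (_ : strip = (fun v : 'rV[R]_2 => v ord0 ord0) @^-1` `]-1, 1[%classic).
  apply: open_comp; last exact: interval_open.
  by move=> v _; exact: coord_continuous.
by apply/seteqP; split => v /=; rewrite in_itv /= => /andP.
Qed.

Lemma glued_strip_open : open glued_strip.
Proof.
rewrite (_ : glued_strip = (fun v : 'rV[R]_2 => eps * v ord0 ord0) @^-1`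
    `]- l false, l true[%classic).
  apply: open_comp; last exact: interval_open.
  by move=> v _; exact: (cvgM (cvg_cst eps) (@coord_continuous R 1 2 ord0 ord0 v)).
by apply/seteqP; split => v /=; rewrite in_itv /= => /andP.
Qed.

Lemma eps_glued_fst x : eps * glued_fst x = l (0 < x) * x.
Proof. by rewrite /glued_fst mulrA eps_eps mul1r. Qed.

Lemma glued_bij : set_bij strip glued_strip glued.
Proof.
have lt := l_gt0 true; have lf := l_gt0 false; split.
- move=> v [h1 h2]; rewrite /glued_strip /glued /= row2_fst eps_glued_fst.
  set x := v ord0 ord0 in h1 h2 *; case: (ltP 0 x) => hx.
    have lx : 0 < l true * x by rewrite mulr_gt0.
    by split; [rewrite (lt_trans _ lx) // oppr_lt0|rewrite gtr_pMr].
  have lx : l false * x <= 0 by rewrite mulr_ge0_le0 // ltW.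
  by split; [rewrite -mulrN1 ltr_pM2l|rewrite (le_lt_trans lx)].
- move=> v v'; rewrite !inE => hv hv' e.
  have [K K0 hK] := glued_bilipschitz.
  have /andP [+ _] := hK _ _ hv hv'; rewrite e subrr normr0.
  rewrite pmulr_rle0 ?invr_gt0 // normr_le0 subr_eq0 => /eqP.
  by [].
- move=> u [hu1 hu2]; pose z := eps * u ord0 ord0; pose b := 0 < z.
  pose x := z / l b.
  have xb : (0 < x) = b by rewrite /x pmulr_lgt0 ?invr_gt0.
  have [[chi psiK chiK] _ _] := psi_tame b.
  pose a := `|x| `^ beta; pose w := u ord0 ord_max.
  (* the second component is inverted by the homogenization of [chi] *)
  pose y := if a == 0 then w / M else a * chi (w / a).
  exists (row2 x y).
    rewrite /strip /= row2_fst /x ltr_pdivlMr ?ltr_pdivrMr // mulN1r mul1r.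
    rewrite -/z in hu1 hu2; move: (l_gt0 b); rewrite /b; case: (ltP 0 z) => hz lb.
      by split; lra.
    by split; lra.
  apply: row2_eq; rewrite /glued ?row2_fst ?row2_snd.
    rewrite /glued_fst xb /x mulrC mulrC [l b * _]mulrC divfK ?gt_eqF //.
    by rewrite /z mulrA eps_eps mul1r.
  rewrite /glued_snd xb /perspective -/a /y.
  case: eqVneq => [_|an]; first by rewrite mulrC divfK.
  by rewrite [a * chi _]mulrC mulfK // chiK mulrC divfK.
Qed.

Lemma glued0 : glued 0 = 0.
Proof.
apply: row2_eq; rewrite /glued ?row2_fst ?row2_snd !mxE.
  by rewrite /glued_fst mulr0 mulr0.
rewrite /glued_snd normr0 powR0; last by rewrite gt_eqF ?beta_gt0.
by rewrite /perspective eqxx mulr0.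
Qed.

Section Polynomials.
Variables (d : nat) (F G : {poly {poly R}}).
Hypotheses (wF : weighted r s d F) (wG : weighted r s d G).
Hypothesis G_psi : forall b t,
  G.[eps * (l b * side_sign b), psi b t] = F.[side_sign b, t].
Hypothesis G_crit : forall b, (G.[(eps * (l b * side_sign b))%:P])^`() != 0.

Lemma side_signM b x : 0 < side_sign b * x ->
  x = (side_sign b * x) * side_sign b /\ `|x| = side_sign b * x /\ (0 < x) = b.
Proof.
case: b => /=; rewrite ?mul1r ?mulN1r ?mulr1 ?mulrN1 ?opprK ?oppr_gt0 => h.
  by rewrite gtr0_norm // h.
by rewrite ltr0_norm // ltNge ltW.
Qed.

Lemma nonzero_side x : x != 0 -> exists b, 0 < side_sign b * x.
Proof.
move=> x0; have [h|h|h] := ltgtP 0 x; [exists true|exists false|].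
- by rewrite mul1r.
- by rewrite mulN1r oppr_gt0.
- by rewrite -h eqxx in x0.
Qed.

(** By quasihomogeneity the equation at [(x, y)] is the equation between
    heights at [y / |x| ^ beta], multiplied by [|x| ^ d]. *)
Lemma glued_eq_neq0 x y : x != 0 -> G.[glued_fst x, glued_snd x y] = F.[x, y].
Proof.
move=> /nonzero_side [b hb]; have [e1 [e2 e3]] := side_signM hb.
set z := side_sign b * x in hb e1 e2.
have a0 : 0 < z `^ beta by rewrite powR_gt0.
rewrite /glued_snd /glued_fst e3 e2 /perspective gt_eqF //.
rewrite e1 (_ : eps * _ = z * (eps * (l b * side_sign b))); last by ring.
rewrite (weighted_scale _ _ s_gt0 wG) // G_psi -(weighted_scale _ _ s_gt0 wF) //.
by rewrite mulrC [_ * (y / _)]mulrC divfK // gt_eqF.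
Qed.

(** On the axis, by continuity from the complement. *)
Lemma glued_eq x y : G.[glued_fst x, glued_snd x y] = F.[x, y].
Proof.
have [->|] := eqVneq x 0; last exact: glued_eq_neq0.
have [K K0 hK] := common_control.
have c1 : glued_fst x @[x --> 0] --> glued_fst 0.
  apply: (@linear_bound_continuous _ _ (l true + l false)) => z _.
  have /andP [_] := glued_fst_bilip z 0.
  by rewrite subr0.
have c2 : glued_snd x y @[x --> 0] --> glued_snd 0 y.
  apply: (@linear_bound_continuous _ (fun x => glued_snd x y) (K * r%:R)) => z z1.
  have n0 : `|0 : R| <= 1 by rewrite normr0.
  by have := glued_snd_lip_x y z1 n0 hK; rewrite subr0.
have c3 := @horner2_continuous _ G _ _ _ c1 c2.
have c4 : F.[x, y] @[x --> 0] --> F.[0, y].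
  by apply: horner2_continuous; [exact: cvg_id|exact: cvg_cst].
have c5 := cvgB c3 c4.
apply/eqP; rewrite -subr_eq0; apply/eqP.
have {}c5 : (fun x => G.[glued_fst x, glued_snd x y] - F.[x, y]) @ 0^' -->
    G.[glued_fst 0, glued_snd 0 y] - F.[0, y].
  by move=> A /c5; rewrite !nbhs_simpl /=; exact: nbhs_dnbhs.
apply: (cvg_unique _ c5) => //.
apply: cvg_near_cst; near=> z; apply/eqP; rewrite subr_eq0; apply/eqP.
apply: glued_eq_neq0; near: z; exact: nbhs_dnbhs_neq.
Unshelve. all: by end_near.
Qed.

(** The homogenized form of the description of the graph of [psi b] by one
    equation and the position relative to the critical points. *)
Lemma branch_graph b (chi : R -> R) (C : seq R) (x y v : R) :
  cancel chi (psi b) ->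
  (forall c, root (G.[(eps * (l b * side_sign b))%:P])^`() c -> c \in C) ->
  0 < side_sign b * x ->
  v = perspective b ((side_sign b * x) `^ beta) y <->
  G.[eps * (l b * x), v] = F.[x, y] /\
  forall c, c \in C -> (c * (side_sign b * x) `^ beta < v) =
    (delta * chi c * (side_sign b * x) `^ beta < delta * y).
Proof.
move=> chiK hC hb; have [e1 _] := side_signM hb.
have [_ mono _] := psi_tame b.
set z := side_sign b * x in hb e1 *.
have a0 : 0 < z `^ beta by rewrite powR_gt0.
rewrite /perspective gt_eqF //; set a := z `^ beta in a0 *.
have aK u : u = a * (u / a) by rewrite mulrC divfK // gt_eqF.
have -> : G.[eps * (l b * x), v] = z ^+ d * G.[eps * (l b * side_sign b), v / a].
  rewrite -(weighted_scale _ _ s_gt0 wG) // -/a -aK; congr (_.[_, _]).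
  by rewrite [in LHS]e1; ring.
have -> : F.[x, y] = z ^+ d * G.[eps * (l b * side_sign b), psi b (y / a)].
  by rewrite G_psi -(weighted_scale _ _ s_gt0 wF) // -/a -aK -e1.
have cmp c : ((c * a < v) = (c < v / a)) *
    ((delta * chi c * a < delta * y) = (c < psi b (y / a))).
  by rewrite -!(ltr_pdivlMr _ _ a0) -[delta * y * _]mulrA mono chiK.
have zd : z ^+ d != 0 by rewrite expf_neq0 // gt_eqF.
split=> [vE|[/(mulfI zd) e hc]].
  have va : v / a = psi b (y / a) by rewrite vE [a * _]mulrC mulfK // gt_eqF.
  by split=> [|c _]; rewrite ?cmp va.
rewrite [LHS]aK; congr (_ * _); apply: (eq_of_same_branch hC).
  exact: e.
by move=> c /hc; rewrite !cmp.
Qed.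

(** The graph is the union of a line over the axis and of one piece over each
    open half-strip, described by [branch_graph]. *)
Lemma glued_semialgebraic : semialgebraic_map strip glued.
Proof.
have cst n c := @polynomial_cst R n c; have coord n i := @polynomial_coord R n i.
split.
  apply: semialgebraic_ext (semialgebraicI (semialgebraic_lt (cst _ (-1)) (coord _ ord0))
    (semialgebraic_lt (coord _ ord0) (cst _ 1))) => v.
  by [].
pose i0 := lshift 2 (ord0 : 'I_2); pose i1 := lshift 2 (ord_max : 'I_2).
pose j0 := rshift 2 (ord0 : 'I_2); pose j1 := rshift 2 (ord_max : 'I_2).
have [chi chiK] : exists chi : bool -> R -> R, forall b, cancel (chi b) (psi b).
  have [[chi1 _ h1] _ _] := psi_tame true; have [[chi2 _ h2] _ _] := psi_tame false.
  by exists (fun b => if b then chi1 else chi2); case.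
have [C hC] : exists C : bool -> seq R, forall b c,
    root (G.[(eps * (l b * side_sign b))%:P])^`() c -> c \in C b.
  have [C1 h1] := all_roots (G_crit true); have [C2 h2] := all_roots (G_crit false).
  by exists (fun b => if b then C1 else C2); case.
(* The sign condition on [x] is repeated inside the equivalence because the
   half-space lemma only speaks of the region where the base is positive. *)
pose side b : set 'rV[R]_(2 + 2) := [set w |
  (0 < side_sign b * w ord0 i0 /\ side_sign b * w ord0 i0 < 1) /\
  (w ord0 j0 = eps * (l b * w ord0 i0) /\
   (G.[w ord0 j0, w ord0 j1] = F.[w ord0 i0, w ord0 i1] /\
    forall c, c \in C b ->
     (0 < side_sign b * w ord0 i0 /\
        c * (side_sign b * w ord0 i0) `^ beta < w ord0 j1) <->
     (0 < side_sign b * w ord0 i0 /\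
        delta * chi b c * (side_sign b * w ord0 i0) `^ beta
          < delta * w ord0 i1)))].
pose axis : set 'rV[R]_(2 + 2) := [set w |
  w ord0 i0 = 0 /\ (w ord0 j0 = 0 /\ w ord0 j1 = M * w ord0 i1)].
have side_sa b : semialgebraic (side b).
  have hx := polynomialZ (side_sign b) (coord _ i0).
  apply: semialgebraicI.
    by apply: semialgebraicI; apply: semialgebraic_lt => //; exact: cst.
  apply: semialgebraicI.
    exact: semialgebraic_eq (coord _ _) (polynomialZ _ (polynomialZ _ (coord _ _))).
  apply: semialgebraicI.
    by apply: semialgebraic_eq; apply: polynomial_horner2.
  apply: semialgebraic_all => c; apply: semialgebraic_iff.
    exact: semialgebraic_lt_powR.
  by apply: semialgebraic_lt_powR => //; exact: polynomialZ.
have axis_sa : semialgebraic axis.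
  apply: semialgebraicI; first exact: semialgebraic_eq (coord _ _) (cst _ _).
  apply: semialgebraicI; first exact: semialgebraic_eq (coord _ _) (cst _ _).
  exact: semialgebraic_eq (coord _ _) (polynomialZ _ (coord _ _)).
apply: semialgebraic_ext (semialgebraicU axis_sa
  (semialgebraicU (side_sa true) (side_sa false))) => w.
set x := w ord0 i0; set y := w ord0 i1; set u := w ord0 j0; set v := w ord0 j1.
have graphE : ([set row_mx v0 (glued v0) | v0 in strip] : set 'rV[R]_(2 + 2)) w <->
    (-1 < x /\ x < 1) /\ (u = glued_fst x /\ v = glued_snd x y).
  split.
    case=> v0 hv0 ew; rewrite /x /y /u /v -ew /i0 /i1 /j0 /j1 !row_mxEl !row_mxEr.
    by rewrite /glued row2_fst row2_snd.
  move=> [hx [hu hv]]; exists (lsubmx w).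
    by rewrite /strip /= mxE.
  rewrite -[RHS]hsubmxK; congr row_mx; apply: row2_eq.
    by rewrite /glued row2_fst !mxE -/i0 -/j0 -/x -/u hu.
  by rewrite /glued row2_snd !mxE -/i0 -/i1 -/j1 -/x -/y -/v hv.
rewrite graphE.
have sideE b : 0 < side_sign b * x ->
    side b w <-> (-1 < x /\ x < 1) /\ (u = glued_fst x /\ v = glued_snd x y).
  move=> hb; have [_ [e2 e3]] := side_signM hb.
  have bnd : (0 < side_sign b * x /\ side_sign b * x < 1) <-> (-1 < x /\ x < 1).
    by move: hb; rewrite /side_sign; case: b {e2 e3} => ?; split; lra.
  rewrite /glued_fst /glued_snd e3 e2 (branch_graph _ _ (chiK b) (hC b) hb).
  rewrite /side /= -/x -/y -/u -/v bnd.
  split=> -[h1 [h2 [h3 h4]]]; split => //; split => //; rewrite h2 in h3 *; split => //.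
    move=> c /h4 h5; apply/idP/idP => h.
      by have [] := h5.1 (conj hb h).
    by have [] := h5.2 (conj hb h).
  by move=> c /h4 ->.
have side_pos b : side b w -> 0 < side_sign b * x by case; case.
have [x0|/nonzero_side [b hb]] := eqVneq x 0.
  have -> : (-1 < x /\ x < 1) /\ (u = glued_fst x /\ v = glued_snd x y) <-> axis w.
    rewrite /axis /= -/x -/y -/u -/v x0 /glued_fst !mulr0 /glued_snd normr0.
    rewrite powR0; last by rewrite gt_eqF ?beta_gt0.
    rewrite /perspective eqxx; split; first by case.
    by case=> _ h; split=> //; split; lra.
  split; last by left.
  by case=> // -[] /side_pos; rewrite x0 mulr0 ltxx.
rewrite -(sideE b hb); split; last by case: b {hb} => h; right; [left|right].
case=> [[x0 _]|].
  by move: hb; rewrite /x x0 mulr0 ltxx.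
case=> h; have := side_pos _ h; case: b hb => //=; rewrite ?mul1r ?mulN1r; lra.
Qed.

Lemma glued_equivalence : semialg_lipschitz_equivalent F G.
Proof.
exists strip, glued_strip, glued; split.
- split; [exact: strip_open|exact: glued_strip_open| |].
    by rewrite /strip /= mxE; split; lra.
  by rewrite /glued_strip /= mxE mulr0 oppr_lt0; split; exact: l_gt0.
- by split; [exact: glued_bij|exact: glued0].
- exact: glued_semialgebraic.
- exact: glued_bilipschitz.
- by move=> v _; rewrite /glued row2_fst row2_snd glued_eq.
Qed.

End Polynomials.
End GluedMap.

(** * Choice of the two one-sided maps *)

Section Assembly.
Variable R : realType.

Lemma tame_of_matched (psi : R -> R) (P Q : {poly R}) n m (delta mu : R) :
  bilipschitz_diffeo psi -> (forall t, P.[psi t] = Q.[t]) ->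
  size P = n.+1 -> size Q = m.+1 -> (0 < n)%N ->
  delta = 1 \/ delta = -1 ->
  (forall x y, (delta * x < delta * y) = (psi x < psi y)) ->
  0 < mu -> `|lead_coef P| * mu ^+ n = `|lead_coef Q| ->
  tame delta (delta * mu) psi.
Proof.
move=> dpsi PQ szP szQ n0 hdelta mono mu0 lead.
have [bij [K K0 hK] der] := dpsi.
have [C1 C10 h1] := asymptotic_slope dpsi PQ szP szQ n0 hdelta mono mu0 lead.
have [C2 C20 h2] := slope_bounded dpsi PQ szP szQ n0.
have h3 := slope_lipschitz der h2.
split => //; exists (K + C1 + C2); first by rewrite addr_gt0 // addr_gt0.
split=> [x y|x y|t|a b y a0 b0].
- have /andP [_ h] := hK x y; apply: le_trans h _; rewrite ler_wpM2r //; lra.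
- have /andP [h _] := hK x y; move: h; rewrite ler_pdivrMl // => h.
  apply: le_trans h _; rewrite ler_wpM2r //; lra.
- by apply: le_trans (h1 t) _; lra.
- by apply: le_trans (h3 a b y a0 b0) _; rewrite ler_wpM2r //; lra.
Qed.

Lemma norm_side_sign b : `|side_sign R b| = 1.
Proof. by case: b; rewrite /= ?normrN normr1. Qed.

Lemma mono_scale (psi : R -> R) (delta : R) (k k' : R) :
  k = 1 \/ k = -1 -> k' = 1 \/ k' = -1 ->
  (forall x y, (delta * x < delta * y) = (psi x < psi y)) ->
  forall x y, ((k * k' * delta) * x < (k * k' * delta) * y) =
     (k * psi (k' * x) < k * psi (k' * y)).
Proof.
move=> hk hk' mono x y.
have flip u v : (k * u < k * v) = if 0 < k then u < v else v < u.
  case: hk => ->; first by rewrite ltr01 !mul1r.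
  by rewrite ltr0N1 !mulN1r ltrN2.
rewrite flip -!mono -!mulrA !flip.
by rewrite ![delta * (k' * _)]mulrCA.
Qed.

Lemma sign_sq (k : R) : k = 1 \/ k = -1 -> k * k = 1.
Proof. by case=> ->; rewrite ?mulrNN mulr1. Qed.

Lemma sign_neq0 (k : R) : k = 1 \/ k = -1 -> k != 0.
Proof. by case=> ->; rewrite ?oppr_eq0 oner_eq0. Qed.

Section FixedPolynomials.
Variables (r s d : nat) (F G : {poly {poly R}}).
Hypotheses (s_gt0 : (0 < s)%N) (lt_sr : (s < r)%N) (coprime_rs : coprime r s).
Hypotheses (wF : weighted r s d F) (wG : weighted r s d G).
Hypotheses (F_neq0 : F != 0) (G_neq0 : G != 0).
Hypotheses (F_ncXd : ~ exists c : R, F = c%:P *: 'X^d)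
           (G_ncXd : ~ exists c : R, G = c%:P *: 'X^d).
Variable eps : R.
Hypothesis eps_sign : eps = 1 \/ eps = -1.
Local Notation side_sign := (@side_sign R).

(** Each side has a slope of absolute value [mu], where
    [mu ^+ n] is the quotient of the leading coefficients of the restrictions of
    [F] and [G].  The last hypothesis makes this quotient independent of the
    side; the common direction [delta] takes care of the sign. *)
Lemma equivalence_of_matched (l : bool -> R) (psi : bool -> R -> R) (delta : R) :
  delta = 1 \/ delta = -1 -> (forall b, 0 < l b) ->
  (forall b, bilipschitz_diffeo (psi b)) ->
  (forall b x y, (delta * x < delta * y) = (psi b x < psi b y)) ->
  (forall b t, G.[eps * (l b * side_sign b), psi b t] = F.[side_sign b, t]) ->
  l true = l false \/ ~ has_factor_X G ->
  semialg_lipschitz_equivalent F G.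
Proof.
move=> hdelta l0 dpsi mono G_psi hl.
have r0 : (0 < r)%N by apply: leq_ltn_trans lt_sr.
have [nF [eF [aF [aF0 nF0 wnF leadF _]]]] :=
  weighted_leading s_gt0 r0 wF F_neq0 F_ncXd.
have [nG [eG [aG [aG0 nG0 wnG leadG noXG]]]] :=
  weighted_leading s_gt0 r0 wG G_neq0 G_ncXd.
have side0 b : side_sign b != 0 by rewrite -normr_eq0 norm_side_sign oner_eq0.
have eps0 : eps != 0 by rewrite -normr_eq0 (norm_eps eps_sign) oner_eq0.
have arg0 b : eps * (l b * side_sign b) != 0.
  by rewrite !mulf_neq0 // gt_eqF.
have szP b := (leadG _ (arg0 b)).1; have lcP b := (leadG _ (arg0 b)).2.
have szQ b := (leadF _ (side0 b)).1; have lcQ b := (leadF _ (side0 b)).2.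
have l_eG b : l b ^+ eG = l true ^+ eG.
  case: hl => [e|/noXG ->]; last by rewrite !expr0.
  by case: b; rewrite ?e.
pose q := `|aF| / (`|aG| * l true ^+ eG).
have q0 : 0 < q by rewrite divr_gt0 ?normr_gt0 // mulr_gt0 ?normr_gt0 // exprn_gt0.
pose mu := q `^ nG%:R^-1.
have mu0 : 0 < mu by rewrite powR_gt0.
have muX : mu ^+ nG = q.
  rewrite -powR_mulrn ?ltW // -powRrM mulVf ?powRr1 ?ltW //.
  by rewrite pnatr_eq0 -lt0n.
have psi_tame b : tame delta (delta * mu) (psi b).
  apply: tame_of_matched (dpsi b) (G_psi b) (szP b) (szQ b) nG0 hdelta (mono b) mu0 _.
  rewrite lcP lcQ !normrM !normrX !normrM (norm_eps eps_sign)
    norm_side_sign expr1n mul1r !mulr1.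
  rewrite (gtr0_norm (l0 b)) l_eG muX mulrC /q divfK //.
  by rewrite mulf_neq0 ?normr_eq0 // expf_neq0 // gt_eqF.
have M0 : delta * mu != 0.
  by rewrite mulf_neq0 ?(gt_eqF mu0) //; case: hdelta => ->; rewrite ?oppr_eq0 oner_eq0.
apply: (glued_equivalence s_gt0 lt_sr eps_sign M0 l0 psi_tame wF wG G_psi) => b.
by rewrite -size_poly_eq0 polyorder.size_deriv szP /= -lt0n.
Qed.

(** The symmetry [(x, y) |-> (- x, (-1) ^+ r * y)] multiplies [F] and [G] by
    the same sign, so conjugating a map for the right half-plane by it gives a
    map for the left half-plane with the same slope. *)
Lemma equivalence_odd (l : R) (psi : R -> R) : odd s -> 0 < l ->
  bilipschitz_diffeo psi -> (forall t, G.[eps * l, psi t] = F.[1, t]) ->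
  semialg_lipschitz_equivalent F G.
Proof.
move=> os l0 dpsi G_psi.
have [delta hdelta mono] := bilipschitz_diffeo_mono dpsi.
pose eta : R := (-1) ^+ r.
have heta : eta = 1 \/ eta = -1.
  by rewrite /eta -signr_odd; case: (odd r); [right|left].
pose psi' b := if b then psi else fun t => eta * psi (eta * t).
have dpsi' b : bilipschitz_diffeo (psi' b).
  case: b; first exact: dpsi.
  by apply: bilipschitz_diffeo_scale dpsi; exact: sign_neq0.
have mono' b x y : (delta * x < delta * y) = (psi' b x < psi' b y).
  case: b; first exact: mono.
  by rewrite /= -(mono_scale heta heta mono) sign_sq // mul1r.
have G_psi' b t : G.[eps * (l * side_sign b), psi' b t] = F.[side_sign b, t].
  case: b => /=; first by rewrite mulr1 G_psi.
  rewrite mulrN1 mulrN (weighted_odd_symm _ _ os wG) G_psi.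
  by rewrite -(weighted_odd_symm _ _ os wF) -/eta mulrA sign_sq // mul1r.
exact: (equivalence_of_matched hdelta (fun=> l0) dpsi' mono' G_psi' (or_introl erefl)).
Qed.

(** As [F] is even in [Y], the left map may be precomposed with [t |-> - t] to
    obtain the direction of the right one. *)
Lemma equivalence_even (l : bool -> R) (phi : bool -> R -> R) : ~~ odd s ->
  (forall b, 0 < l b) -> (forall b, bilipschitz_diffeo (phi b)) ->
  (forall b t, G.[eps * (l b * side_sign b), phi b t] = F.[side_sign b, t]) ->
  l true = l false \/ ~ has_factor_X G ->
  semialg_lipschitz_equivalent F G.
Proof.
move=> es l0 dphi G_phi hl.
have [d1 hd1 mono1] := bilipschitz_diffeo_mono (dphi true).
have [d2 hd2 mono2] := bilipschitz_diffeo_mono (dphi false).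
pose k := d1 * d2.
have hk : k = 1 \/ k = -1.
  by rewrite /k; case: hd1 => ->; case: hd2 => ->; rewrite ?mulrNN ?mulr1 ?mul1r; auto.
pose psi b := if b then phi true else fun t => 1 * phi false (k * t).
have dpsi b : bilipschitz_diffeo (psi b).
  case: b; first exact: dphi.
  by apply: bilipschitz_diffeo_scale (dphi false); rewrite ?oner_eq0 ?sign_neq0.
have mono b x y : (d1 * x < d1 * y) = (psi b x < psi b y).
  case: b; first exact: mono1.
  rewrite /= -(mono_scale (or_introl erefl) hk mono2).
  by have -> : 1 * k * d2 = d1 by rewrite mul1r /k -mulrA (sign_sq hd2) mulr1.
have G_psi b t : G.[eps * (l b * side_sign b), psi b t] = F.[side_sign b, t].
  case: b => /=; first exact: (G_phi true).
  rewrite mul1r; have := G_phi false (k * t); rewrite /= => ->.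
  case: hk => ->; first by rewrite mul1r.
  by rewrite mulN1r (weighted_even_symm _ _ coprime_rs es wF).
exact: (equivalence_of_matched hd1 l0 dpsi mono G_psi hl).
Qed.

End FixedPolynomials.

End Assembly.

Theorem theorem2 (R : realType) (r s d : nat) (F G : {poly {poly R}})
    (lambda : R * R) (phi : (R -> R) * (R -> R))
    (s_gt0 : (0 < s)%N) (lt_sr : (s < r)%N) (coprime_rs : coprime r s)
    (d_ge1 : (1 <= d)%N)
    (F_qh : quasihomogeneous (r%:R / s%:R) d F)
    (G_qh : quasihomogeneous (r%:R / s%:R) d G)
    (F_ncXd : ~ exists c : R, F = c%:P *: 'X^d)
    (G_ncXd : ~ exists c : R, G = c%:P *: 'X^d)
    (lambda_phi : proto_transition lambda phi)
    (comp_eq : proto_comp d (height_right G, height_left G) lambda phi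
               = (height_right F, height_left F))
    (cond : [\/ (~~ odd r) || odd s, lambda.1 = lambda.2
              | ~ has_factor_X F /\ ~ has_factor_X G]) :
  semialg_lipschitz_equivalent F G.
Proof.
have [[l1 l2 l12] [n1 b1] [n2 b2]] := lambda_phi.
have wF := quasihomogeneous_weighted s_gt0 F_qh.
have wG := quasihomogeneous_weighted s_gt0 G_qh.
have [F0 _] := F_qh; have [G0 _] := G_qh.
pose l b := if b then `|lambda.1| else `|lambda.2|.
pose phib b := if b then phi.1 else phi.2.
have l0 b : 0 < l b by case: b; rewrite /= normr_gt0.
have dphi b : bilipschitz_diffeo (phib b).
  by case: b; apply: bilipschitz_diffeo_of_nash.
have [eps heps matched] : exists2 eps : R, eps = 1 \/ eps = -1 &
    forall b t, l b ^+ d * G.[eps * side_sign R b, phib b t] = F.[side_sign R b, t].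
  move: comp_eq; rewrite /proto_comp; case: ifP => _ e.
    exists 1; first by left.
    case=> t; rewrite mul1r.
      by have := congr1 (fun p => p.1 t) e.
    by have := congr1 (fun p => p.2 t) e.
  exists (-1); first by right.
  case=> t; rewrite ?mulrNN mulr1.
    by have := congr1 (fun p => p.1 t) e.
  by have := congr1 (fun p => p.2 t) e.
pose beta : R := r%:R / s%:R.
pose psi b t := l b `^ beta * phib b (1 * t).
have dpsi b : bilipschitz_diffeo (psi b).
  by apply: bilipschitz_diffeo_scale; rewrite ?oner_eq0 // gt_eqF // powR_gt0.
have G_psi b t : G.[eps * (l b * side_sign R b), psi b t] = F.[side_sign R b, t].
  by rewrite mulrCA (weighted_scale _ _ s_gt0 wG) // mul1r matched.
have [os|es] := boolP (odd s).
  apply: (equivalence_odd s_gt0 lt_sr wF wG F0 G0 F_ncXd G_ncXd heps os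
    (l0 true) (dpsi true)).
  by move=> t; have := G_psi true t; rewrite mulr1.
apply: (equivalence_even s_gt0 lt_sr coprime_rs wF wG F0 G0 F_ncXd G_ncXd heps es
  l0 dpsi G_psi).
case: cond => [|e|[_ h]]; [|by left; rewrite /l e|by right].
rewrite (negbTE es) orbF => er; move: coprime_rs.
have : (2 %| gcdn r s)%N by rewrite dvdn_gcd !dvdn2 er es.
by rewrite /coprime => + /eqP g; rewrite g.
Qed.
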